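(* Consider the extended rigid body system on $\mathbb{R}^{3\times3}\times\mathbb{R}^3$, $$\dot R=R\hat\Omega-k_{\rm e}R(R^TR-I),\qquad \dot\Omega=\mathbb{I}^{-1}(\mathbb{I}\Omega\times\Omega)+\mathbb{I}^{-1}u,$$ with $k_{\rm e}>0$, and a bounded reference trajectory $(R_0(t),\Omega_0(t))\in\mathrm{SO}(3)\times\mathbb{R}^3$ with bounded control $u_0(t)$, $t\ge0$, satisfying $\dot R_0=R_0\hat\Omega_0$ and $\dot\Omega_0=\mathbb{I}^{-1}(\mathbb{I}\Omega_0\times\Omega_0)+\mathbb{I}^{-1}u_0$. Let $\Delta R=R-R_0(t)$, $\Delta\Omega=\Omega-\Omega_0(t)$, $\Delta u=u-u_0(t)$, $Z=R_0(t)^T\Delta R$, $Z_k=\tfrac12(Z-Z^T)$. Let $z_{\rm o}=(Z^\vee_{k,\rm est},\Delta\Omega_{\rm est})\in\mathbb{R}^3\times\mathbb{R}^3$ be the state of the observer $$\dot z_{\rm o}=A(t)z_{\rm o}+B\Delta u-L(t)(Cz_{\rm o}-Z_k^\vee),$$ where $$A(t)=\begin{bmatrix}-\hat\Omega_0(t)&I\\0&\mathbb{I}^{-1}(\widehat{\mathbb{I}\Omega_0(t)}-\hat\Omega_0(t)\mathbb{I})\end{bmatrix},\quad B=\begin{bmatrix}0\\ \mathbb{I}^{-1}\end{bmatrix},\quad C=\begin{bmatrix}I&0\end{bmatrix},\quad L(t)=\begin{bmatrix}L_1(t)\\L_2(t)\end{bmatrix},$$ $$L_1(t)=-\hat\Omega_0(t)+\mathbb{I}^{-1}(\widehat{\mathbb{I}\Omega_0(t)}-\hat\Omega_0(t)\mathbb{I})+M_1,$$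 $$L_2(t)=-(\hat{\dot\Omega}_0(t)+\dot L_1(t))+(\hat\Omega_0(t)+L_1(t))^2-M_1(\hat\Omega_0(t)+L_1(t))+M_2,$$ with any constant $3\times3$ positive definite symmetric matrices $M_1$ and $M_2$. Let $k_P>0$ and let $K_D=K_D^T\in\mathbb{R}^{3\times3}$ be positive definite. Then the controller $$u=u_0-(\mathbb{I}\Delta\Omega_{\rm est})\times\Omega_0-(\mathbb{I}\Omega_0)\times\Delta\Omega_{\rm est}-\mathbb{I}(k_PZ^\vee_{k,\rm est}+K_D\Delta\Omega_{\rm est})$$ exponentially stabilizes the tracking error dynamics, i.e. the dynamics of $(\Delta R,\Delta\Omega)$ (equivalently, of $(Z,\Delta\Omega)$).
   Context: $\mathbb{I}$ is the ($3\times3$, symmetric positive definite) moment of inertia matrix. For $\Omega=(\Omega_1,\Omega_2,\Omega_3)\in\mathbb{R}^3$, $\hat\Omega$ is the skew-symmetric matrix with $\hat\Omega y=\Omega\times y$ for all $y\in\mathbb{R}^3$; $\vee$ denotes the inverse map, so $(\hat\Omega)^\vee=\Omega$. $\hat{\dot\Omega}_0$ is the hat map applied to $\dot\Omega_0$. On $\mathrm{SO}(3)\times\mathbb{R}^3$ the extended system coincides with the rigid body system $\dot R=R\hat\Omega$, $\dot\Omega=\mathbb{I}^{-1}(\mathbb{I}\Omega\times\Omega)+\mathbb{I}^{-1}u$. The measured output is $R$. ''Exponentially stabilizes the tracking error dynamics'' means: for the closed loop consisting of the extended rigid body system and the observer, written in the variables $(\Delta R,\Delta\Omega,e_{\rm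 o})$ with $e_{\rm o}=(Z_k^\vee,\Delta\Omega)-z_{\rm o}$, the origin is an exponentially stable equilibrium point: there are $c,\kappa,\lambda>0$ such that every solution $\xi$ with $\|\xi(t_0)\|<c$ satisfies $\|\xi(t)\|\le\kappa\|\xi(t_0)\|e^{-\lambda(t-t_0)}$ for all $t\ge t_0\ge0$. *)

(* Defs.v *)
From HB Require Import structures.
From mathcomp Require Import all_boot all_order all_algebra.
From mathcomp Require Import all_classical all_reals all_analysis.

Set Implicit Arguments.
Unset Strict Implicit.
Unset Printing Implicit Defensive.

Import Order.TTheory GRing.Theory Num.Theory.
Import numFieldNormedType.Exports.

Local Open Scope classical_set_scope.
Local Open Scope ring_scope.

Section Matrices.
Variable R : realType.

Definition posdefmx n (A : 'M[R]_n) : Prop :=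
  A^T = A /\ forall x : 'cV[R]_n, x != 0 -> 0 < (x^T *m A *m x) 0 0.

Definition SO3 : set 'M[R]_3 := [set A | A^T *m A = 1%:M /\ \det A = 1].

(* Indices are added in 'I_3, i.e. modulo 3. *)
Definition cross (x y : 'cV[R]_3) : 'cV[R]_3 :=
  \col_i (x (i + 1) 0 * y (i + 2) 0 - x (i + 2) 0 * y (i + 1) 0).

Definition hat (w : 'cV[R]_3) : 'M[R]_3 :=
  \matrix_(i, j) cross w (delta_mx j 0) i 0.

(* Total function; only meaningful on skew-symmetric matrices, where it is the
   inverse of [hat] (see [veeK]). *)
Definition vee (S : 'M[R]_3) : 'cV[R]_3 := \col_i S (i + 2) (i + 1).

Lemma hatE (w y : 'cV[R]_3) : hat w *m y = cross w y.
Proof.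
have sum_delta (i : 'I_3) : \sum_j (i == j)%:R * y j 0 = y i 0.
  rewrite (bigD1 i) //= eqxx mul1r big1 ?addr0 // => j.
  by rewrite eq_sym => /negPf ->; rewrite mul0r.
apply/colP => i; rewrite !mxE.
under eq_bigr do rewrite !mxE !andbT mulrBl -!mulrA.
by rewrite sumrB -!mulr_sumr !sum_delta.
Qed.

Lemma hatK : cancel hat vee.
Proof.
move=> w; apply/colP => i; rewrite !mxE !eqxx !andbT.
by case: i => [[|[|[|//]]] ?]; rewrite /= !(mulr0, mulr1, sub0r, subr0, opprK);
  congr (w _ _); apply/val_inj.
Qed.

Lemma hat_skew w : (hat w)^T = - hat w.
Proof.
apply/matrixP => i j; rewrite !mxE !andbT.
case: i => [[|[|[|//]]] ?]; case: j => [[|[|[|//]]] ?];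
  rewrite /= !(mulr0, mulr1, sub0r, subr0, opprK, oppr0) //;
  by [congr (- w _ _); apply/val_inj | congr (w _ _); apply/val_inj].
Qed.

Lemma veeK (S : 'M[R]_3) : S^T = - S -> hat (vee S) = S.
Proof.
move=> skS.
have sk i j : S i j = - S j i by rewrite -[in LHS](trmxK S) skS !mxE.
have sk0 (i j : 'I_3) : i = j :> nat -> S i j = 0.
  move=> /val_inj ->; have : S j j *+ 2 == 0 by rewrite mulr2n {1}sk addNr.
  by rewrite mulrn_eq0 => /eqP.
have Sval (i j k l : 'I_3) : i = k :> nat -> j = l :> nat -> S i j = S k l.
  by move=> /val_inj -> /val_inj ->.
apply/matrixP => i j; rewrite !mxE !andbT.
case: i => [[|[|[|//]]] ?]; case: j => [[|[|[|//]]] ?];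
  rewrite /= !(mulr0, mulr1, sub0r, subr0, oppr0);
  by [rewrite sk0 | rewrite -?sk; apply: Sval].
Qed.

End Matrices.

Section ODE.
Variables (R : realType) (V : normedModType R).

Definition time_interval (t0 : R) (T : \bar R) : set R :=
  [set t | t0 <= t /\ (t%:E < T)%E].

(* At the left endpoint only continuity is required, so that trajectories need
   not be meaningful before [t0]. *)
Definition ode_solution (F : R -> V -> V) (t0 : R) (T : \bar R) (x : R -> V) :=
  {within time_interval t0 T, continuous x} /\
  forall t, t0 < t -> (t%:E < T)%E -> is_derive t 1 x (F t (x t)).

(* [sol t0 T xi] : [xi] is a solution on [t0, T[ of the dynamics.  Solutions
   on bounded intervals are included, and are estimated for as long as they
   exist. *)
Definition exponentially_stable_origin (sol : R -> \bar R -> (R -> V) -> Prop) :=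
  sol 0 +oo%E (fun=> 0) /\
  exists c kappa lambda : R, [/\ 0 < c, 0 < kappa, 0 < lambda &
    forall (t0 : R) (T : \bar R) (xi : R -> V),
      0 <= t0 -> sol t0 T xi -> `|xi t0| < c ->
      forall t, t0 <= t -> (t%:E < T)%E ->
        `|xi t| <= kappa * `|xi t0| * expR (- lambda * (t - t0))].

End ODE.

Section RigidBody.
Variables (R : realType) (J : 'M[R]_3).

Definition euler_rhs (Om u : 'cV[R]_3) : 'cV[R]_3 :=
  invmx J *m cross (J *m Om) Om + invmx J *m u.

Definition rigid_body (u : R -> 'cV[R]_3) (t : R)
    (x : 'M[R]_3 * 'cV[R]_3) : 'M[R]_3 * 'cV[R]_3 :=
  (x.1 *m hat x.2, euler_rhs x.2 (u t)).

Definition extended_rigid_body (ke : R) (u : 'cV[R]_3)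
    (x : 'M[R]_3 * 'cV[R]_3) : 'M[R]_3 * 'cV[R]_3 :=
  (x.1 *m hat x.2 - ke *: (x.1 *m (x.1^T *m x.1 - 1%:M)), euler_rhs x.2 u).

Definition reference_trajectory (R0 : R -> 'M[R]_3) (Om0 u0 : R -> 'cV[R]_3) :=
  [/\ forall t, 0 <= t -> SO3 (R0 t),
      ode_solution (rigid_body u0) 0 +oo%E (fun t => (R0 t, Om0 t)),
      [bounded (R0 t, Om0 t) | t in time_interval 0 +oo%E] &
      [bounded u0 t | t in time_interval 0 +oo%E]].

Section Observer.
Variables (M1 M2 : 'M[R]_3) (R0 : R -> 'M[R]_3) (Om0 : R -> 'cV[R]_3).

(* Z_k^vee, as a function of the time and of the measured output [Q] = R. *)
Definition Zk_vee (t : R) (Q : 'M[R]_3) : 'cV[R]_3 :=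
  let Z := (R0 t)^T *m (Q - R0 t) in vee (2^-1 *: (Z - Z^T)).

Definition euler_lin (t : R) : 'M[R]_3 :=
  invmx J *m (hat (J *m Om0 t) - hat (Om0 t) *m J).

Definition obs_A (t : R) : 'M[R]_(3 + 3) :=
  block_mx (- hat (Om0 t)) 1%:M 0 (euler_lin t).
Definition obs_B : 'M[R]_(3 + 3, 3) := col_mx 0 (invmx J).
Definition obs_C : 'M[R]_(3, 3 + 3) := row_mx 1%:M 0.

Definition obs_L1 (t : R) : 'M[R]_3 := - hat (Om0 t) + euler_lin t + M1.
Definition obs_L2 (t : R) : 'M[R]_3 :=
  let N := hat (Om0 t) + obs_L1 t in
  - (hat (derive1 Om0 t) + derive1 obs_L1 t) + N *m N - M1 *m N + M2.
Definition obs_L (t : R) : 'M[R]_(3 + 3, 3) := col_mx (obs_L1 t) (obs_L2 t).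

Definition observer (t : R) (Q : 'M[R]_3) (du : 'cV[R]_3)
    (z : 'cV[R]_(3 + 3)) : 'cV[R]_(3 + 3) :=
  obs_A t *m z + obs_B *m du - obs_L t *m (obs_C *m z - Zk_vee t Q).

Variables (kP : R) (KD : 'M[R]_3) (u0 : R -> 'cV[R]_3).

Definition controller (t : R) (z : 'cV[R]_(3 + 3)) : 'cV[R]_3 :=
  let Zest := usubmx z in
  let dOm_est := dsubmx z in
  u0 t - cross (J *m dOm_est) (Om0 t) - cross (J *m Om0 t) dOm_est
  - J *m (kP *: Zest + KD *m dOm_est).

Definition closed_loop (ke : R) (t : R)
    (x : 'M[R]_3 * 'cV[R]_3 * 'cV[R]_(3 + 3)) :
    'M[R]_3 * 'cV[R]_3 * 'cV[R]_(3 + 3) :=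
  let u := controller t x.2 in
  (extended_rigid_body ke u x.1, observer t x.1.1 (u - u0 t) x.2).

(* (R, Omega, z_o) |-> (Delta R, Delta Omega, e_o) *)
Definition error_coordinates (t : R)
    (x : 'M[R]_3 * 'cV[R]_3 * 'cV[R]_(3 + 3)) :
    'M[R]_3 * 'cV[R]_3 * 'cV[R]_(3 + 3) :=
  let dR := x.1.1 - R0 t in
  let dOm := x.1.2 - Om0 t in
  (dR, dOm, col_mx (Zk_vee t x.1.1) dOm - x.2).

(* The coordinate change is invertible at each time, so this is the closed loop
   written in the variables (Delta R, Delta Omega, e_o).  The norm on their
   space is the library's (max) norm. *)
Definition error_dynamics (ke : R) (t0 : R) (T : \bar R)
    (xi : R -> 'M[R]_3 * 'cV[R]_3 * 'cV[R]_(3 + 3)) : Prop :=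
  exists2 x, ode_solution (closed_loop ke) t0 T x &
    forall t, time_interval t0 T t -> xi t = error_coordinates t (x t).

End Observer.
End RigidBody.

(* Main.v *)
From HB Require Import structures.
Require Import Defs.
From mathcomp Require Import all_boot all_order all_algebra.
From mathcomp Require Import all_classical all_reals all_analysis.
From mathcomp Require Import ring lra.
Import numFieldNormedType.Exports.
Import Order.TTheory GRing.Theory Num.Theory.
Local Open Scope classical_set_scope.
Local Open Scope ring_scope.

Set Implicit Arguments.
Unset Strict Implicit.
Unset Printing Implicit Defensive.

(* Let Z = R0^T (R - R0), Y = Z + Z^T, x = Z_k^vee and y = Omega - Omega_0.  Up to
   terms of second order the closed loop reads
     Y' = [Y, Om0^] - 2 ke Y,   x' = - Om0^ x + y,   y' = - kP x - KD y + (linear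
   in the observer error).
   Let N = Om0^ + L_1.  The gains L_1 and L_2 are exactly those for which the
   observer error (e1, e2), written in the variables e1 and v = e2 - N e1, obeys
     e1' = v,   v' = - M2 e1 - M1 v   up to second order;
   the derivatives of Omega_0 and L_1 cancel.  Both second order systems have the
   Lyapunov function <x, K x> + |y|^2 + 2 eps <x, y>, with eps small.  Since the
   coupling is triangular, |Y|^2 plus the first one plus a large multiple of the
   second one is a Lyapunov function W with W' <= - a W near the origin, uniformly
   in time because the reference is bounded. *)

(** * Matrices: norms, calculus, positive definite forms *)

(** The linearized error system varies with time through the reference, so eigenvalues do not decide
    its stability. Explicit quadratic functions do, with constants that depend on the reference only
    through a bound [B]. The time-varying skew terms are harmless because they are orthogonal to
    what they act on: [Y, Om0^] to Y, and Om0^ x to x, hence to kP x since kP is a scalar. Splitting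
    Z into Y and x isolates the directions transversal to SO(3), which are damped by the ke term
    alone. The functions are built from smooth inner products, while sizes are measured in the max
    norm; explicit dimension factors link the two. Near the origin the remainders are quadratic in
    the error size, so they enter W' as cubic terms and lose against - a W. The inequality for W' is
    therefore only local, and a first-exit argument keeps W below the right level on the whole
    interval of existence, bounded or not. *)

Section MatrixNorm.
Variable R : realType.

Lemma norm_entry m n (A : 'M[R]_(m, n)) i j : `|A i j| <= `|A|.
Proof.
by rewrite [leRHS]/Num.norm/= mx_normrE; exact: (le_bigmax _ _ (i, j)).
Qed.

Lemma norm_mx_le m n (A : 'M[R]_(m, n)) (e : R) :
  0 <= e -> (forall i j, `|A i j| <= e) -> `|A| <= e.
Proof.
by move=> e0 Ae; rewrite [leLHS]/Num.norm/= mx_normrE; apply: bigmax_le => // i _.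
Qed.

Lemma norm_trmx m n (A : 'M[R]_(m, n)) : `|A^T| = `|A|.
Proof.
have le p q (B : 'M[R]_(p, q)) : `|B^T| <= `|B|.
  by apply: norm_mx_le => // i j; rewrite mxE norm_entry.
by apply/le_anti; rewrite le/= -{1}[A]trmxK le.
Qed.

(** The norm is the largest absolute value of an entry, which is not submultiplicative: each entry
    of the product has [n] terms, hence the factor. *)
Lemma norm_mulmx m n p (A : 'M[R]_(m, n)) (B : 'M[R]_(n, p)) :
  `|A *m B| <= n%:R * `|A| * `|B|.
Proof.
apply: norm_mx_le => [|i j]; first by rewrite !mulr_ge0.
rewrite mxE (le_trans (ler_norm_sum _ _ _))//.
have -> : n%:R * `|A| * `|B| = \sum_(k < n) `|A| * `|B|.
  by rewrite sumr_const card_ord -mulrA mulr_natl.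
by apply: ler_sum => k _; rewrite normrM ler_pM ?norm_entry.
Qed.

Lemma linear_mx_delta (V : lmodType R) m n (L : {linear 'M[R]_(m, n) -> V}) A :
  L A = \sum_i \sum_j A i j *: L (delta_mx i j).
Proof.
rewrite {1}[A]matrix_sum_delta linear_sum; apply: eq_bigr => i _.
by rewrite linear_sum; apply: eq_bigr => j _; rewrite linearZ.
Qed.

Lemma linear_mx_bounded (V : normedModType R) m n
    (L : {linear 'M[R]_(m, n) -> V}) :
  exists2 k : R, 0 <= k & forall A, `|L A| <= k * `|A|.
Proof.
exists (\sum_i \sum_j `|L (delta_mx i j)|) => [|A].
  by apply: sumr_ge0 => i _; apply: sumr_ge0.
rewrite linear_mx_delta (le_trans (ler_norm_sum _ _ _))// mulr_suml.
apply: ler_sum => i _; rewrite (le_trans (ler_norm_sum _ _ _))// mulr_suml.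
by apply: ler_sum => j _; rewrite normrZ mulrC ler_wpM2l ?norm_entry.
Qed.

Lemma cvg_sumr (V : normedModType R) (T : Type) (F : set_system T) {FF : Filter F}
    (I : Type) (r : seq I) (f : I -> T -> V) (a : I -> V) :
  (forall i, f i @ F --> a i) ->
  (fun x => \sum_(i <- r) f i x) @ F --> \sum_(i <- r) a i.
Proof. by move=> fa; apply: cvg_big => // x; exact: add_continuous. Qed.

Lemma linear_mx_continuous (V : normedModType R) m n
    (L : {linear 'M[R]_(m, n) -> V}) : continuous L.
Proof.
have -> : (L : _ -> _) = fun A => \sum_i \sum_j A i j *: L (delta_mx i j).
  by apply/funext => A; exact: linear_mx_delta.
move=> A; apply: (@cvg_sumr _ _ (nbhs A)) => i; apply: (@cvg_sumr _ _ (nbhs A)) => j.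
by apply: cvgZr_tmp; exact: coord_continuous.
Qed.

End MatrixNorm.

Section InnerProduct.
Variable R : realType.

(** Frobenius inner product, the Euclidean one on columns. It can be differentiated, unlike the max
    norm. *)
Definition dot m n (A B : 'M[R]_(m, n)) : R := \tr (A^T *m B).

Lemma dotE m n (A B : 'M[R]_(m, n)) : dot A B = \sum_j \sum_i A i j * B i j.
Proof.
by apply: eq_bigr => j _; rewrite mxE; apply: eq_bigr => i _; rewrite !mxE.
Qed.

Lemma dotC m n (A B : 'M[R]_(m, n)) : dot A B = dot B A.
Proof. by rewrite /dot -mxtrace_tr trmx_mul trmxK. Qed.

Lemma dotDl m n (A B C : 'M[R]_(m, n)) : dot (A + B) C = dot A C + dot B C.
Proof. by rewrite /dot linearD /= mulmxDl linearD. Qed.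

Lemma dotDr m n (A B C : 'M[R]_(m, n)) : dot C (A + B) = dot C A + dot C B.
Proof. by rewrite /dot mulmxDr linearD. Qed.

Lemma dotNl m n (A B : 'M[R]_(m, n)) : dot (- A) B = - dot A B.
Proof. by rewrite /dot linearN /= mulNmx linearN. Qed.

Lemma dotNr m n (A B : 'M[R]_(m, n)) : dot A (- B) = - dot A B.
Proof. by rewrite /dot mulmxN linearN. Qed.

Lemma dotZl m n (k : R) (A B : 'M[R]_(m, n)) : dot (k *: A) B = k * dot A B.
Proof. by rewrite /dot linearZ /= -scalemxAl linearZ. Qed.

Lemma dotZr m n (k : R) (A B : 'M[R]_(m, n)) : dot A (k *: B) = k * dot A B.
Proof. by rewrite dotC dotZl dotC. Qed.

Lemma dot_mull m n p (M : 'M[R]_(m, n)) (A : 'M[R]_(n, p)) B :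
  dot (M *m A) B = dot A (M^T *m B).
Proof. by rewrite /dot trmx_mul mulmxA. Qed.

Lemma norm_dot m n (A B : 'M[R]_(m, n)) :
  `|dot A B| <= (n * m)%:R * (`|A| * `|B|).
Proof.
rewrite dotE (le_trans (ler_norm_sum _ _ _))//.
have -> : (n * m)%:R * (`|A| * `|B|) = \sum_(j < n) \sum_(i < m) `|A| * `|B|.
  by rewrite !sumr_const !card_ord -mulrnA mulr_natl mulnC.
apply: ler_sum => j _; rewrite (le_trans (ler_norm_sum _ _ _))//.
by apply: ler_sum => i _; rewrite normrM ler_pM ?norm_entry.
Qed.

Lemma dot_ge_norm m n (A : 'M[R]_(m, n)) : `|A| ^+ 2 <= dot A A.
Proof.
have sq i j : `|A i j| ^+ 2 <= dot A A.
  rewrite dotE (bigD1 j)//= (bigD1 i)//= real_normK ?num_real// -expr2 -addrA lerDl.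
  rewrite addr_ge0// sumr_ge0// => k _; first by rewrite -expr2 sqr_ge0.
  by rewrite sumr_ge0// => l _; rewrite -expr2 sqr_ge0.
have d0 : 0 <= dot A A.
  by rewrite dotE !sumr_ge0// => j _; rewrite sumr_ge0// => i _; rewrite -expr2 sqr_ge0.
rewrite -(@ler_sqrt _ _ (dot A A))// sqrtr_sqr normr_id.
apply: norm_mx_le => // i j.
by rewrite -(@sqrtr_sqr _ (A i j)) ler_sqrt// -real_normK ?num_real.
Qed.

End InnerProduct.

Section MatrixCalculus.
Variable R : realType.

Lemma cvg_mx (T : Type) (F : set_system T) {FF : Filter F} m n
    (f : T -> 'M[R]_(m, n)) (l : 'M[R]_(m, n)) :
  (forall i j, f x i j @[x --> F] --> l i j) -> f @ F --> l.
Proof.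
move=> fl; apply/cvgrPdist_le => /= e e0; near=> x.
apply: norm_mx_le; first exact: ltW.
move=> i j; rewrite !mxE; move: i j; near: x.
apply: filter_forall => i; apply: filter_forall => j.
exact: ((cvgrPdist_le _ _).1 (fl i j)).
Unshelve. all: by end_near. Qed.

Lemma cvg_entry (T : Type) (F : set_system T) {FF : Filter F} m n
    (f : T -> 'M[R]_(m, n)) (l : 'M[R]_(m, n)) i j :
  f @ F --> l -> f x i j @[x --> F] --> l i j.
Proof.
move=> fl; exact: (@continuous_cvg _ _ _ F _ f (fun M : 'M[R]_(m, n) => M i j) l
  (@coord_continuous _ _ _ _ _ _)).
Qed.

Lemma cvg_mulmx (T : Type) (F : set_system T) {FF : Filter F} m n p
    (f : T -> 'M[R]_(m, n)) (g : T -> 'M[R]_(n, p)) (a : 'M[R]_(m, n)) (b : 'M[R]_(n, p)) :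
  f @ F --> a -> g @ F --> b -> (fun x => f x *m g x) @ F --> a *m b.
Proof.
move=> fa gb; apply: cvg_mx => i j; rewrite mxE.
under eq_fun do rewrite mxE.
by apply: (@cvg_sumr R) => k; apply: cvgM; exact: cvg_entry.
Qed.

Lemma cvg_dot (T : Type) (F : set_system T) {FF : Filter F} m n
    (f g : T -> 'M[R]_(m, n)) (a b : 'M[R]_(m, n)) :
  f @ F --> a -> g @ F --> b -> (fun x => dot (f x) (g x)) @ F --> dot a b.
Proof.
move=> fa gb; apply: (@cvg_sumr R) => j.
apply: cvg_entry; apply: cvg_mulmx => //.
exact: (@continuous_cvg _ _ _ F _ f trmx a (@linear_mx_continuous _ _ _ _ trmx _)).
Qed.

Lemma is_derive_mxP (V : normedModType R) m n (f : V -> 'M[R]_(m, n)) t v df :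
  is_derive t v f df <-> forall i j, is_derive t v (fun x => f x i j) (df i j).
Proof.
split=> [[fd <-] i j|fd].
  by rewrite derive_mx// mxE; apply: derivableP; move/derivable_mxP: fd.
have fd' : derivable f t v by apply/derivable_mxP => i j; have [] := fd i j.
apply: DeriveDef => //; rewrite derive_mx//; apply/matrixP => i j.
by rewrite mxE; have [] := fd i j.
Qed.

Lemma is_derive_mulmx (V : normedModType R) m n p (f : V -> 'M[R]_(m, n))
    (g : V -> 'M[R]_(n, p)) t v df dg :
  is_derive t v f df -> is_derive t v g dg ->
  is_derive t v (fun x => f x *m g x) (df *m g t + f t *m dg).
Proof.
move=> /is_derive_mxP fd /is_derive_mxP gd; apply/is_derive_mxP => i j.
have -> : (fun x => (f x *m g x) i j) =
    \sum_k ((fun x => f x i k) * (fun x => g x k j)).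
  by apply/funext => x; rewrite mxE fct_sumE.
have H k := is_deriveM (fd i k) (gd k j).
have S := @is_derive_sum _ _ _ _ _ _ _ _ H.
apply: (is_derive_eq S).
rewrite !mxE -big_split/=; apply: eq_bigr => k _.
by rewrite addrC [g t k j *: _]mulrC.
Qed.

Lemma is_derive_linear (U V W : normedModType R) (L : {linear V -> W})
    (f : U -> V) t v df : continuous L ->
  is_derive t v f df -> is_derive t v (fun x => L (f x)) (L df).
Proof.
move=> cL [fd fdf].
have E : (fun h => h^-1 *: (L (f (h *: v + t)) - L (f t))) =
    L \o (fun h => h^-1 *: (f (h *: v + t) - f t)).
  by apply/funext => h /=; rewrite -(linearB L) -linearZ.
have H : h^-1 *: (L (f (h *: v + t)) - L (f t)) @[h --> 0^'] --> L df.
  by rewrite E -fdf; apply: (continuous_cvg _ (cL _)).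
by apply: DeriveDef; [apply/cvg_ex; exists (L df)|exact: cvg_lim H].
Qed.

Lemma is_derive_linear_mx (U V : normedModType R) m n
    (L : {linear 'M[R]_(m, n) -> V}) (f : U -> 'M[R]_(m, n)) t v df :
  is_derive t v f df -> is_derive t v (fun x => L (f x)) (L df).
Proof. by move=> fd; apply: is_derive_linear fd; exact: linear_mx_continuous. Qed.

Lemma is_derive_pair (U V W : normedModType R) (f : U -> V) (g : U -> W) t v
    df dg :
  is_derive t v f df -> is_derive t v g dg ->
  is_derive t v (fun x => (f x, g x)) (df, dg).
Proof.
move=> [fd fdf] [gd gdg].
have H : h^-1 *: ((f (h *: v + t), g (h *: v + t)) - (f t, g t))
    @[h --> 0^'] --> (df, dg).
  by rewrite -fdf -gdg; apply: cvg_pair.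
by apply: DeriveDef; [apply/cvg_ex; exists (df, dg)|exact: cvg_lim H].
Qed.

Lemma is_derive_fst (U V W : normedModType R) (f : U -> V * W) t v df :
  is_derive t v f df -> is_derive t v (fun x => (f x).1) df.1.
Proof. by apply: is_derive_linear => x; exact: cvg_fst. Qed.

Lemma is_derive_snd (U V W : normedModType R) (f : U -> V * W) t v df :
  is_derive t v f df -> is_derive t v (fun x => (f x).2) df.2.
Proof. by apply: is_derive_linear => x; exact: cvg_snd. Qed.

Lemma is_derive_dot (V : normedModType R) m n (f g : V -> 'M[R]_(m, n)) t v df dg :
  is_derive t v f df -> is_derive t v g dg ->
  is_derive t v (fun x => dot (f x) (g x)) (dot df (g t) + dot (f t) dg).
Proof.
move=> fd gd.
have fd' := is_derive_linear_mx trmx fd.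
have := is_derive_linear_mx (@mxtrace R n : {linear _ -> R^o}) (is_derive_mulmx fd' gd).
by rewrite linearD.
Qed.

End MatrixCalculus.

Section PositiveDefinite.
Variables (R : realType) (n : nat).

Lemma posdef_unitmx (A : 'M[R]_n) : posdefmx A -> A \in unitmx.
Proof.
move=> [_ Apos]; rewrite unitmxE unitfE; apply/negP => /det0P[v v0 vA].
have := Apos v^T; rewrite trmxK vA mul0mx mxE ltxx => H.
suff : false by [].
by apply: H; rewrite -(inj_eq trmx_inj) trmxK trmx0.
Qed.

Lemma posdef_scalar (k : R) : 0 < k -> posdefmx (k%:M : 'M[R]_n).
Proof.
move=> k0; split=> [|x x0]; first exact: tr_scalar_mx.
rewrite mul_mx_scalar -scalemxAl mxE mulr_gt0//.
have := dot_ge_norm x; rewrite /dot /mxtrace big_ord1; apply: lt_le_trans.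
by rewrite exprn_gt0// normr_gt0.
Qed.

(* By compactness of the unit sphere. *)
Lemma posdef_coercive (A : 'M[R]_n) : posdefmx A ->
  exists2 k : R, 0 < k & forall x : 'cV_n, k * `|x| ^+ 2 <= dot x (A *m x).
Proof.
move=> [_ Apos].
pose S : set 'rV[R]_n := [set x | `|x| = 1].
pose f (x : 'rV[R]_n) := dot x^T (A *m x^T).
have sphere (x : 'cV[R]_n) : x != 0 -> S (`|x|^-1 *: x)^T.
  move=> x0; rewrite /S /= norm_trmx normrZ normfV normr_id mulVf//.
  by rewrite normr_eq0.
(* The sphere is empty only in dimension 0, where [x = 0] and any constant works. *)
have [S0|S0] := pselect (S !=set0); last first.
  exists 1 => // x; have [->|/sphere Sx] := eqVneq x 0.
    by rewrite normr0 expr0n mulr0 /dot !mulmx0 mxtrace0.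
  by exfalso; apply: S0; eexists; exact: Sx.
have cS : compact S.
  apply: bounded_closed_compact.
    by exists 1; split => // M M1 x /= ->; exact: ltW.
  have -> : S = (@Num.norm R 'rV[R]_n) @^-1` [set 1] by [].
  by apply: preimage_closed => [x _|]; [exact: norm_continuous|exact: closed_eq].
have cf : continuous f.
  move=> x; have ct : trmx y @[y --> x] --> (x^T : 'cV[R]_n).
    exact: linear_mx_continuous.
  apply: (cvg_dot ct).
  exact: (@continuous_cvg _ _ _ (nbhs x) _ trmx (mulmx A) _ (@linear_mx_continuous _ _ _ _ _ _)).
have [c /set_mem Sc cmin] := compact_EVT_min S0 cS (continuous_subspaceT cf).
exists (f c).
  rewrite /f /dot /mxtrace big_ord1 mulmxA; apply: Apos.
  apply/eqP => /(congr1 trmx); rewrite trmxK trmx0 => c0.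
  by move: Sc; rewrite /S /= c0 normr0 => /esym/eqP; rewrite oner_eq0.
move=> x; have [->|x0] := eqVneq x 0.
  by rewrite normr0 expr0n mulr0 /dot !mulmx0 mxtrace0.
have /mem_set/cmin := sphere _ x0.
rewrite {2}/f trmxK -scalemxAr dotZl dotZr mulrA -expr2 exprVn mulrC.
by rewrite ler_pdivlMr// exprn_gt0// normr_gt0.
Qed.

End PositiveDefinite.

(** * Exponential decay from a local differential inequality *)

Section Comparison.
Variable R : realType.

Lemma decreasing_derive (f df : R -> R) (a b : R) :
  a <= b -> {within `[a, b], continuous f} ->
  (forall t, a < t < b -> is_derive t 1 f (df t)) ->
  (forall t, a < t < b -> df t <= 0) -> f b <= f a.
Proof.
move=> ab fc fd fd0; have [->//|anb] := eqVneq a b.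
have ltab : a < b by rewrite lt_neqAle anb.
have fd' x : x \in `]a, b[%R -> is_derive x 1 f (df x).
  by rewrite in_itv; exact: fd.
have [c cab E] := MVT ltab fd' fc.
rewrite -subr_le0 E mulr_le0_ge0 ?subr_ge0//.
by apply: fd0; move: cab; rewrite in_itv.
Qed.

(** The inequality is assumed only where [W <= delta]. At the first time where [W] reaches [delta]
    it would have held ever since [t0], so [W] would not exceed [W t0 < delta] there, a
    contradiction. Hence it holds throughout and can be integrated. *)
Lemma lyapunov_decay (W dW : R -> R) (t0 : R) (T : \bar R) (a delta : R) :
  0 <= a -> {within time_interval t0 T, continuous W} ->
  (forall t, t0 < t -> (t%:E < T)%E -> is_derive t 1 W (dW t)) ->
  (forall t, t0 < t -> (t%:E < T)%E -> W t <= delta -> dW t <= - a * W t) ->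
  (forall t, time_interval t0 T t -> 0 <= W t) -> W t0 < delta ->
  forall t, time_interval t0 T t -> W t <= W t0 * expR (- a * (t - t0)).
Proof.
move=> a0 Wc Wd Wa W0 Wt0.
have ltT t s : s <= t -> (t%:E < T)%E -> (s%:E < T)%E.
  by move=> st; apply: le_lt_trans; rewrite lee_fin.
have sub t : (t%:E < T)%E -> `[t0, t] `<=` time_interval t0 T.
  by move=> tT s /=; rewrite in_itv/= => /andP[? ?]; split => //; exact: ltT tT.
have Wdelta t : time_interval t0 T t -> W t < delta.
  move=> [t0t tT]; rewrite ltNge; apply/negP => dWt.
  pose E := [set s | t0 <= s <= t /\ delta <= W s].
  have Et : E t by split=> //; rewrite t0t /=.
  have hE : has_inf E.
    by split; [exists t|exists t0 => s [/andP[]]].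
  pose tau := inf E.
  have tau0 : t0 <= tau by apply: lb_le_inf => //; [exists t|move=> s [/andP[]]].
  have tau1 : tau <= t by apply: ge_inf => //; exact: hE.2.
  have tauT := ltT _ _ tau1 tT.
  have Itau : time_interval t0 T tau by [].
  (* If [W tau < delta], continuity would keep [W] below [delta] near [tau], yet [E] has elements
     arbitrarily close to its infimum. *)
  have Wtau : delta <= W tau.
    rewrite leNgt; apply/negP => Wtau.
    have /subspace_continuousP/(_ _ Itau)/cvgrPdist_lt := Wc.
    move=> /(_ (delta - W tau)); rewrite subr_gt0 => /(_ Wtau).
    rewrite /within /= => /nbhs_ballP[e /= e0 He].
    have [s Es se] := inf_adherent e0 hE.
    have taus : tau <= s by apply: ge_inf => //; exact: hE.2.
    have [/andP[t0s st] Ws] := Es.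
    have /= := He s; rewrite /ball /= distrC ger0_norm ?subr_ge0// ltrBlDr addrC.
    move=> /(_ se) /(_ (conj t0s (ltT _ _ st tT))).
    rewrite ltr_norml /from_subspace => /andP[+ _]; lra.
  have lt0tau : t0 < tau.
    by rewrite lt_neqAle tau0 andbT; apply/eqP => e; move: Wtau; rewrite -e leNgt Wt0.
  have : W tau <= W t0.
    apply: (@decreasing_derive _ dW) => //.
    - exact: continuous_subspaceW (sub _ tauT) Wc.
    - by move=> s /andP[s0 s1]; apply: Wd => //; exact: ltT (ltW s1) tauT.
    - move=> s /andP[s0 s1]; have sT := ltT _ _ (ltW s1) tauT.
      have Ws : W s < delta.
        rewrite ltNge; apply/negP => dWs; have := s1; rewrite ltNge => /negP; apply.
        apply: ge_inf; first exact: hE.2.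
        by split=> //; rewrite (ltW s0)/=; apply: le_trans (ltW s1) tau1.
      apply: (le_trans (Wa _ s0 sT (ltW Ws))).
      by rewrite mulNr oppr_le0 mulr_ge0// W0//; split => //; exact: ltW.
  lra.
move=> t [t0t tT].
(* Integrating factor: the inequality makes [g] nonincreasing. *)
pose g s := W s * expR (a * (s - t0)).
have ed (s : R) : is_derive s (1 : R) (fun s : R => expR (a * (s - t0))) (a * expR (a * (s - t0))).
  have H : is_derive s (1 : R) (fun s : R => a * (s - t0)) a.
    have := is_deriveZ a (is_deriveB (is_derive_id s 1) (is_derive_cst t0 s 1)).
    by rewrite subr0 [a *: 1]mulr1.
  by have := @is_derive1_comp _ expR _ s _ _ (is_derive_expR _) H; rewrite mulrC.
suff : g t <= g t0.
  rewrite /g subrr mulr0 expR0 mulr1 mulNr expRN.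
  by rewrite ler_pdivlMr// expR_gt0.
apply: (@decreasing_derive _ (fun s => dW s * expR (a * (s - t0)) + W s * (a * expR (a * (s - t0))))) => //.
- apply/subspace_continuousP => s Is; apply: cvgM.
    by have /subspace_continuousP := continuous_subspaceW (sub _ tT) Wc; apply.
  suff : {within `[t0, t], continuous (fun s : R => expR (a * (s - t0)))}.
    by move/subspace_continuousP; apply.
  by apply: derivable_within_continuous => r _; have [] := ed r.
- move=> s /andP[s0 s1]; have sT := ltT _ _ (ltW s1) tT.
  have H := is_deriveM (Wd _ s0 sT) (ed s).
  by apply: (is_derive_eq H); rewrite addrC [_ *: dW s]mulrC.
- move=> s /andP[s0 s1]; have sT := ltT _ _ (ltW s1) tT.
  have Is : time_interval t0 T s by split => //; exact: ltW.
  have := Wa _ s0 sT (ltW (Wdelta _ Is)).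
  have := expR_gt0 (a * (s - t0)).
  nra.
Qed.

End Comparison.

(** * Second order systems with damping *)

Section SecondOrder.
Variables (R : realType) (n : nat).
Implicit Types (K D G : 'M[R]_n) (x y p q : 'cV[R]_n).

Definition energy K (eps : R) x y :=
  dot x (K *m x) + dot y y + 2 * eps * dot x y.

Definition energy_dot K (eps : R) x y dx dy :=
  2 * dot dx (K *m x) + 2 * dot dy y + 2 * eps * (dot dx y + dot x dy).

Lemma is_derive_energy (V : normedModType R) K (eps : R) (f g : V -> 'cV[R]_n)
    t v df dg : K^T = K -> is_derive t v f df -> is_derive t v g dg ->
  is_derive t v (fun s => energy K eps (f s) (g s))
    (energy_dot K eps (f t) (g t) df dg).
Proof.
move=> Ksym fd gd.
have Kfd := is_derive_linear_mx (mulmx K) fd.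
have := is_deriveD (is_deriveD (is_derive_dot fd Kfd) (is_derive_dot gd gd))
  (is_deriveZ (2 * eps) (is_derive_dot fd gd)).
move=> /is_derive_eq; apply.
rewrite [(2 * eps) *: _]mulrC (dotC (f t) (K *m df)) dot_mull Ksym (dotC (g t) dg).
rewrite /energy_dot; ring.
Qed.

(** By Young's inequality 2 h X Y <= k X^2 + (h^2/k) Y^2, half of the term in X^2 survives. The
    remaining eps (2 nu + h^2/k) Y^2 is at most d Y^2, half of the damping, as soon as eps <= [a2].
    The bound 4 nu^2 eps <= k, ensured by [a1], serves to keep the energy positive definite. *)
Lemma cross_weight (k d nu h : R) : 0 < k -> 0 < d -> 0 <= nu -> 0 <= h ->
  exists2 eps : R, 0 < eps <= 1 & 4 * nu ^+ 2 * eps <= k /\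
    forall X Y, 2 * eps * (nu * Y ^+ 2 + h * (X * Y) - k * X ^+ 2) -
      2 * d * Y ^+ 2 <= - (eps * k) * X ^+ 2 - d * Y ^+ 2.
Proof.
move=> k0 d0 nu0 h0; pose w := h ^+ 2 / k.
have w0 : 0 <= w by rewrite /w divr_ge0 ?sqr_ge0// ltW.
have n20 := sqr_ge0 nu.
pose a1 := k / (4 * nu ^+ 2 + 1); pose a2 := d / (2 * nu + w + 1).
have a10 : 0 < a1 by rewrite divr_gt0//; lra.
have a20 : 0 < a2 by rewrite divr_gt0//; lra.
have : Num.min 1 (Num.min a1 a2) <= 1 by rewrite ge_min lexx.
have : Num.min 1 (Num.min a1 a2) <= a1 by rewrite !ge_min lexx orbT.
have : Num.min 1 (Num.min a1 a2) <= a2 by rewrite !ge_min lexx !orbT.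
have : 0 < Num.min 1 (Num.min a1 a2) by rewrite !lt_min ltr01 a10 a20.
move: (Num.min _ _) => eps eps0 e2 e1 e3.
exists eps; first by rewrite eps0.
move: e1 e2; rewrite !ler_pdivlMr; [|lra|lra] => e1 e2.
split; first by nra.
move=> X Y.
have wE : w * k = h ^+ 2 by rewrite /w divfK// gt_eqF.
have AG : 2 * h * (X * Y) <= k * X ^+ 2 + w * Y ^+ 2.
  rewrite -(ler_pM2l k0) -subr_ge0.
  have -> : k * (k * X ^+ 2 + w * Y ^+ 2) - k * (2 * h * (X * Y)) =
    (k * X - h * Y) ^+ 2 by rewrite mulrDr (mulrA k w) (mulrC k w) wE; ring.
  exact: sqr_ge0.
have := ler_wpM2l (ltW eps0) AG.
have := ler_wpM2r (sqr_ge0 Y) e2.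
have := mulr_ge0 (ltW eps0) (sqr_ge0 Y).
lra.
Qed.

(* The cross term [2 eps <x, y>] makes the derivative of the energy negative
   definite, although the damping [D] acts on [y] only. *)
Lemma energy_decay K D (g : R) : posdefmx K -> posdefmx D -> 0 <= g ->
  exists eps c C m M : R, [/\ 0 < c, 0 <= C, 0 < m & 0 <= M] /\
    (forall x y, m * (`|x| + `|y|) ^+ 2 <= energy K eps x y <=
                 M * (`|x| + `|y|) ^+ 2) /\
    (forall G x y p q, `|G| <= g -> dot (G *m x) (K *m x) = 0 ->
      energy_dot K eps x y (y + G *m x + p) (- (K *m x) - D *m y + q) <=
      - c * (`|x| + `|y|) ^+ 2 + C * (`|x| + `|y|) * (`|p| + `|q|)).
Proof.
move=> Kpos Dpos g0.
have [k k0 kK] := posdef_coercive Kpos; have [d d0 dD] := posdef_coercive Dpos.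
pose nu : R := (1 * n)%:R; pose kap := nu * (n%:R * `|K|).
pose h := nu * (n%:R * g + n%:R * `|D|).
have nu0 : 0 <= nu by [].
have kap0 : 0 <= kap by rewrite !mulr_ge0.
have h0 : 0 <= h by rewrite mulr_ge0// addr_ge0 ?mulr_ge0.
have [eps /andP[eps0 eps1] [epsk Heps]] := cross_weight k0 d0 nu0 h0.
have dotle x y : `|dot x y| <= nu * (`|x| * `|y|) by exact: norm_dot.
have dotmul (A : 'M[R]_n) x y : `|dot x (A *m y)| <= nu * (n%:R * `|A|) * (`|x| * `|y|).
  apply: (le_trans (dotle _ _)); rewrite -[leRHS]mulrA ler_wpM2l//.
  have := ler_wpM2l (normr_ge0 x) (norm_mulmx A y); lra.
(* The divisors come from (X + Y)^2 <= 2 (X^2 + Y^2); in the lower bound of the energy, a further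
   half pays for the cross term. In [2 * kap + 4 * nu], <p, K x> contributes 2 kap, while <q, y> and
   the cross term contribute 2 nu each, as eps <= 1. *)
exists eps, (Num.min (eps * k) d / 2), (2 * kap + 4 * nu), (Num.min k 1 / 4), (kap + nu).
have m0 : 0 < Num.min (eps * k) d by rewrite lt_min mulr_gt0.
have m1 : 0 < Num.min k 1 by rewrite lt_min k0 ltr01.
split; [split; [lra|lra|lra|lra]|split].
  move=> x y.
  have X0 := normr_ge0 x; have Y0 := normr_ge0 y.
  have Kx := kK x; have yy := dot_ge_norm y.
  have /ler_normlP[vl vr] := dotle x y.
  have /ler_normlP[_ ur] := dotmul K x x.
  have /ler_normlP[_ wr] := dotle y y.
  have mk : Num.min k 1 <= k by rewrite ge_min lexx.
  have ml : Num.min k 1 <= 1 by rewrite ge_min lexx orbT.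
  have m2 : Num.min k 1 / 4 * (`|x| + `|y|) ^+ 2 <= (k * `|x| ^+ 2 + `|y| ^+ 2) / 2.
    have := ler_wpM2r (sqr_ge0 `|x|) mk; have := ler_wpM2r (sqr_ge0 `|y|) ml.
    have := mulr_ge0 (ltW m1) (sqr_ge0 (`|x| - `|y|)); lra.
  have ev1 := ler_wpM2l (ltW eps0) vl; have ev2 := ler_wpM2l (ltW eps0) vr.
  have XY0 := mulr_ge0 nu0 (mulr_ge0 X0 Y0).
  have ev3 := ler_wpM2r XY0 eps1.
  (* Gives 4 eps nu X Y <= 4 eps^2 nu^2 X^2 + Y^2 <= k X^2 + Y^2: the cross term costs at most half
     of the quadratic part. *)
  have ev4 := sqr_ge0 (2 * eps * nu * `|x| - `|y|).
  have ev5 := ler_wpM2r (sqr_ge0 `|x|) (ler_wpM2l (ltW eps0) epsk).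
  have ev6 := ler_wpM2r (mulr_ge0 (ltW k0) (sqr_ge0 `|x|)) eps1.
  have kXY := mulr_ge0 kap0 (mulr_ge0 X0 Y0).
  rewrite -/kap in ur.
  have nX := mulr_ge0 nu0 (sqr_ge0 `|x|); have kY := mulr_ge0 kap0 (sqr_ge0 `|y|).
  by rewrite /energy; apply/andP; split; lra.
move=> G x y p q Gg GK.
(* [GK] removes [G] from the derivative of <x, K x>. What is left of [G] carries the factor eps and
   is absorbed through [h]. *)
rewrite /energy_dot !(dotDl, dotDr, dotNl, dotNr) GK (dotC y (K *m x)) (dotC (D *m y)).
have X0 := normr_ge0 x; have Y0 := normr_ge0 y.
have P0 := normr_ge0 p; have Q0 := normr_ge0 q.
have /ler_normlP[_ b1] := dotmul K p x; rewrite -/kap in b1.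
have /ler_normlP[_ b2] := dotle q y.
have /ler_normlP[_ b3] := dotle y y.
have /ler_normlP[_ b4] := dotmul G y x.
have /ler_normlP[b5 _] := dotmul D x y.
have /ler_normlP[_ b6] := dotle p y.
have /ler_normlP[_ b7] := dotle x q.
have b8 := kK x; have b9 := dD y.
have b10 := ler_wpM2r (mulr_ge0 X0 Y0) (ler_wpM2l nu0 (ler_wpM2l (ler0n R n) Gg)).
rewrite (dotC (G *m x)).
have S1 : dot y y + dot y (G *m x) - dot x (K *m x) - dot x (D *m y) <=
    nu * `|y| ^+ 2 + h * (`|x| * `|y|) - k * `|x| ^+ 2 by rewrite /h; lra.
have S2 : dot p y + dot x q <= nu * (`|p| * `|y| + `|x| * `|q|) by lra.
have S3 := Heps `|x| `|y|.
have {}S1 := ler_wpM2l (ltW eps0) S1.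
have {}S2 := ler_wpM2l (ltW eps0) S2.
have PY := mulr_ge0 nu0 (mulr_ge0 P0 Y0); have PX := mulr_ge0 nu0 (mulr_ge0 P0 X0).
have QY := mulr_ge0 nu0 (mulr_ge0 Q0 Y0); have QX := mulr_ge0 nu0 (mulr_ge0 Q0 X0).
have S4 : eps * (nu * (`|p| * `|y| + `|x| * `|q|)) <=
    nu * (`|p| * `|y| + `|x| * `|q|).
  by rewrite ler_piMl// mulrDr addr_ge0//; lra.
have mk : Num.min (eps * k) d <= eps * k by rewrite ge_min lexx.
have ml : Num.min (eps * k) d <= d by rewrite ge_min lexx orbT.
have S5 : Num.min (eps * k) d / 2 * (`|x| + `|y|) ^+ 2 <=
    eps * k * `|x| ^+ 2 + d * `|y| ^+ 2.
  have := ler_wpM2r (sqr_ge0 `|x|) mk; have := ler_wpM2r (sqr_ge0 `|y|) ml.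
  have := mulr_ge0 (ltW m0) (sqr_ge0 (`|x| - `|y|)); lra.
have KPY := mulr_ge0 kap0 (mulr_ge0 P0 Y0); have KQX := mulr_ge0 kap0 (mulr_ge0 Q0 X0).
have KQY := mulr_ge0 kap0 (mulr_ge0 Q0 Y0).
lra.
Qed.

End SecondOrder.

(** * Rotation and velocity errors *)

Section Hat.
Variable R : realType.
Implicit Types (w x y : 'cV[R]_3) (Z : 'M[R]_3).

Lemma cyclic_addE (i : 'I_3) :
  [/\ i + 1 + 1 = i + 2, i + 1 + 2 = i, i + 2 + 1 = i & i + 2 + 2 = i + 1].
Proof. by split; case: i => [[|[|[|//]]] ?]; apply/val_inj. Qed.

(** Expanding a sum from index [i] on allows identities about [hat] to be checked on a generic
    entry, without splitting on [i]. *)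
Lemma sum_cyclic (F : 'I_3 -> R) i : \sum_j F j = F i + F (i + 1) + F (i + 2).
Proof.
rewrite (@perm_big _ _ _ _ _ [:: i; i + 1; i + 2]).
  by rewrite !big_cons big_nil /= addr0 addrA.
apply: uniq_perm; [exact: index_enum_uniq|by case: i => [[|[|[|//]]] ?]|].
move=> j; rewrite mem_index_enum !inE.
by case: i => [[|[|[|//]]] ?]; case: j => [[|[|[|//]]] ?].
Qed.

Lemma hat_entry w i : [/\ hat w i i = 0, hat w i (i + 1) = - w (i + 2) 0 &
  hat w i (i + 2) = w (i + 1) 0].
Proof.
rewrite !mxE !eqxx !andbT.
split; case: i => [[|[|[|//]]] ?];
  rewrite /= !(mulr0, mulr1, sub0r, subr0, opprK, oppr0) //.
Qed.

Lemma hat_is_linear : linear (@hat R).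
Proof. by move=> k x y; apply/matrixP => i j; rewrite !mxE; ring. Qed.
HB.instance Definition _ := GRing.isLinear.Build R 'cV[R]_3 'M[R]_3 *:%R
  (@hat R) hat_is_linear.

Lemma vee_is_linear : linear (@vee R).
Proof. by move=> k x y; apply/colP => i; rewrite !mxE. Qed.
HB.instance Definition _ := GRing.isLinear.Build R 'M[R]_3 'cV[R]_3 *:%R
  (@vee R) vee_is_linear.

Lemma hat_mulC x y : hat x *m y = - (hat y *m x).
Proof. by rewrite !hatE; apply/colP => i; rewrite !mxE; ring. Qed.

(* [Zk_vee R0 t Q] is convertible to [skewv ((R0 t)^T *m (Q - R0 t))]. *)
Definition skewv Z : 'cV[R]_3 := vee (2^-1 *: (Z - Z^T)).

Lemma skewv_is_linear : linear skewv.
Proof. by move=> k x y; apply/colP => i; rewrite !mxE; ring. Qed.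
HB.instance Definition _ := GRing.isLinear.Build R 'M[R]_3 'cV[R]_3 *:%R
  skewv skewv_is_linear.

Lemma skewv_sym Z : Z^T = Z -> skewv Z = 0.
Proof. by move=> sZ; rewrite /skewv sZ subrr scaler0 linear0. Qed.

Lemma skewv_hat w : skewv (hat w) = w.
Proof.
rewrite /skewv hat_skew -[RHS]hatK; congr vee; move: (hat w) => H.
by apply/matrixP => i j; rewrite !mxE; field.
Qed.

Lemma hat_skewv Z : hat (skewv Z) = 2^-1 *: (Z - Z^T).
Proof. by rewrite veeK// linearZ/= linearB/= trmxK -scalerN opprB. Qed.

(** The bracket of a symmetric and a skew matrix is symmetric, so only the skew part of [Z] counts;
    on skew matrices the bracket is the cross product. *)
Lemma skewv_commutator Z w :
  skewv (Z *m hat w - hat w *m Z) = - (hat w *m skewv Z).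
Proof.
(* An opaque copy of [hat w], so that [mxE] does not unfold its entries before [hat_entry] is
   applied. *)
have [H HE] : exists H : 'M[R]_3, H = hat w by exists (hat w).
rewrite -HE; apply/colP => i.
have [a1 a2 a3 a4] := cyclic_addE i.
have := hat_entry w i; have := hat_entry w (i + 1); have := hat_entry w (i + 2).
rewrite -{}HE a1 a2 a3 a4 => -[c1 c2 c3] [b1 b2 b3] [d1 d2 d3].
rewrite !mxE !(sum_cyclic _ i) !mxE a1 a2 a3 a4 c1 c2 c3 b1 b2 b3 d1 d2 d3.
ring.
Qed.

End Hat.

Section TransposeLemmas.
Variable R : realType.

Lemma trmxD m n (A B : 'M[R]_(m, n)) : (A + B)^T = A^T + B^T.
Proof. exact: linearD. Qed.

Lemma trmxN m n (A : 'M[R]_(m, n)) : (- A)^T = - A^T.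
Proof. exact: linearN. Qed.

Lemma trmxZ m n (k : R) (A : 'M[R]_(m, n)) : (k *: A)^T = k *: A^T.
Proof. exact: linearZ. Qed.

(** Infinitesimal form of the invariance of the Frobenius norm under conjugation by rotations. *)
Lemma dot_commutator_sym n (Y H : 'M[R]_n) : Y^T = Y -> H^T = - H ->
  dot (Y *m H - H *m Y) Y = 0.
Proof.
move=> Ysym Hskew; rewrite dotDl dotNl /dot !trmx_mul Ysym Hskew.
by rewrite mxtrace_mulC mulmxA subrr.
Qed.

End TransposeLemmas.

(** * Evolution of Z and of its symmetric and skew parts *)

Section RotationError.
Variable R : realType.
Implicit Types (w y : 'cV[R]_3) (Z : 'M[R]_3).

(** The terms of order at least two in Z'. As R0^T R = I + Z, the ke term is (I + Z)(Z + Z^T + Z^T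
    Z), and its linear part Z + Z^T is symmetric. *)
Definition rot_rem (ke : R) Z y : 'M[R]_3 :=
  Z *m hat y - ke *: (Z^T *m Z + Z *m (Z + Z^T + Z^T *m Z)).

Definition rot_dot (ke : R) w Z y : 'M[R]_3 :=
  hat y + (Z *m hat w - hat w *m Z) - ke *: (Z + Z^T) + rot_rem ke Z y.

Lemma is_derive_rot (ke : R) (R0 Q : R -> 'M[R]_3) (t : R) w y :
  SO3 (R0 t) -> is_derive t 1 R0 (R0 t *m hat w) ->
  is_derive t 1 Q
    (Q t *m hat (w + y) - ke *: (Q t *m ((Q t)^T *m Q t - 1%:M))) ->
  is_derive t 1 (fun s => (R0 s)^T *m (Q s - R0 s))
    (rot_dot ke w ((R0 t)^T *m (Q t - R0 t)) y).
Proof.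
move=> [orth _] R0d Qd.
have := is_derive_mulmx (is_derive_linear_mx trmx R0d) (is_deriveB Qd R0d).
move=> /is_derive_eq; apply => /=.
have orth' : R0 t *m (R0 t)^T = 1%:M by apply: mulmx1C.
have RQ : (R0 t)^T *m Q t = 1%:M + (R0 t)^T *m (Q t - R0 t).
  by rewrite mulmxBr orth addrC subrK.
have QQ : (Q t)^T *m Q t = ((R0 t)^T *m Q t)^T *m ((R0 t)^T *m Q t).
  by rewrite trmx_mul trmxK mulmxA -(mulmxA _ (R0 t)) orth' mulmx1.
rewrite QQ RQ -[(Q - R0) t]/(Q t - R0 t) trmx_mul hat_skew -(mulmxA (- _)).
move: (Q t - R0 t) RQ => dQ RQ.
rewrite 2!(mulmxBr (R0 t)^T) -scalemxAr 2!(mulmxA _ (Q t)) RQ (mulmxA _ (R0 t)).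
rewrite orth mul1mx; move: ((R0 t)^T *m _) => Z; rewrite /rot_dot /rot_rem.
rewrite trmxD trmx1 linearD/= !(mulmxDl, mulmxDr, mulNmx, mulmxN, mul1mx, mulmx1).
rewrite !mulmxA.
(* The products become atoms, so that [mxE] does not expand them and [ring] sees an identity between
   their entries. *)
move: (hat y) (hat w) (Z *m hat y) (Z *m hat w) (hat w *m _) => k h c b a.
move: (Z *m Z) (Z^T *m Z) (Z *m Z^T) (Z *m Z^T *m Z) => g f e d.
by apply/matrixP => i j; rewrite !mxE; ring.
Qed.

Lemma is_derive_skewv_rot (ke : R) (Zf : R -> 'M[R]_3) (t : R) w y :
  is_derive t 1 Zf (rot_dot ke w (Zf t) y) ->
  is_derive t 1 (fun s => skewv (Zf s))
    (y - hat w *m skewv (Zf t) + skewv (rot_rem ke (Zf t) y)).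
Proof.
move=> /(is_derive_linear_mx (@skewv R))/is_derive_eq; apply.
rewrite /rot_dot linearD/=; congr (_ + _).
rewrite linearB/= linearD/= linearZ/= skewv_commutator skewv_hat.
by rewrite (@skewv_sym _ (_ + _)) ?scaler0 ?subr0// linearD/= trmxK addrC.
Qed.

Definition sym_rot_dot ke w Z y :=
  (Z + Z^T) *m hat w - hat w *m (Z + Z^T) - (2 * ke) *: (Z + Z^T) +
  (rot_rem ke Z y + (rot_rem ke Z y)^T).

Lemma is_derive_sym_rot (ke : R) (Zf : R -> 'M[R]_3) (t : R) w y :
  is_derive t 1 Zf (rot_dot ke w (Zf t) y) ->
  is_derive t 1 (fun s => Zf s + (Zf s)^T) (sym_rot_dot ke w (Zf t) y).
Proof.
move=> Zd; have := is_deriveD Zd (is_derive_linear_mx trmx Zd).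
move=> /is_derive_eq; apply.
rewrite /rot_dot /sym_rot_dot; move: (hat_skew y) (rot_rem ke _ _) => + q.
move: (Zf t) (hat y) => Z Y Yskew; rewrite /= !(trmxD, trmxN, trmxZ, trmx_mul).
rewrite hat_skew Yskew trmxK mulmxDl mulmxDr mulNmx mulmxN.
move: (_ *m hat w) (hat w *m _) (_ *m hat w) (hat w *m _) => a b c d.
by apply/matrixP => i j; rewrite !mxE; ring.
Qed.

Lemma sym_rot_decay (ke : R) w Z y :
  2 * dot (sym_rot_dot ke w Z y) (Z + Z^T) =
  - (4 * ke) * dot (Z + Z^T) (Z + Z^T) +
  2 * dot (rot_rem ke Z y + (rot_rem ke Z y)^T) (Z + Z^T).
Proof.
have Ysym : (Z + Z^T)^T = Z + Z^T by rewrite trmxD trmxK addrC.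
rewrite /sym_rot_dot; move: (rot_rem _ _ _ + _) => q; move: (Z + Z^T) Ysym => Y Ysym.
by rewrite 2!dotDl (dot_commutator_sym Ysym (hat_skew w)) dotNl dotZl; ring.
Qed.

End RotationError.

(** * Velocity error in Euler's equation *)

Section BodyError.
Variables (R : realType) (J : 'M[R]_3).
Implicit Types (w y u : 'cV[R]_3).

(* [euler_lin J Om0 t] is convertible to [gyro J (Om0 t)]. *)
Definition gyro w : 'M[R]_3 := invmx J *m (hat (J *m w) - hat w *m J).

Lemma gyro_is_linear : linear gyro.
Proof.
move=> k x y; rewrite /gyro.
have -> : hat (J *m (k *: x + y)) - hat (k *: x + y) *m J =
    k *: (hat (J *m x) - hat x *m J) + (hat (J *m y) - hat y *m J).
  rewrite mulmxDr -scalemxAr !linearP/= mulmxDl -scalemxAl.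
  move: (hat _ *m _) (hat _ *m _) (hat _) (hat _) => a b c d.
  by apply/matrixP => i j; rewrite !mxE; ring.
by rewrite mulmxDr -scalemxAr.
Qed.
HB.instance Definition _ := GRing.isLinear.Build R 'cV[R]_3 'M[R]_3 *:%R
  gyro gyro_is_linear.

Definition gyro_rem y : 'cV[R]_3 := invmx J *m (hat (J *m y) *m y).

(** The right-hand side is the derivative of J^-1 (J w x w) in the direction [y]. In this form it
    meets the two cross products of the controller. *)
Lemma gyroE w y : gyro w *m y =
  invmx J *m (cross (J *m w) y + cross (J *m y) w).
Proof.
rewrite /gyro -mulmxA mulmxBl -mulmxA -!hatE; congr (_ *m (_ + _)).
by rewrite (hat_mulC (J *m y)).
Qed.

(** J w x w is quadratic in w, so its second-order expansion is exact. *)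
Lemma euler_error w y u u' :
  euler_rhs J (w + y) u - euler_rhs J w u' =
  gyro w *m y + gyro_rem y + invmx J *m (u - u').
Proof.
rewrite gyroE /gyro_rem /euler_rhs -!mulmxDr -mulmxBr -!hatE; congr (_ *m _).
rewrite (mulmxDr J) (linearD (@hat R))/= mulmxDl !mulmxDr.
move: (hat _ *m _) (hat _ *m _) (hat _ *m _) (hat _ *m _) => a b c d.
by apply/matrixP => i j; rewrite !mxE; ring.
Qed.

End BodyError.

(** * Observer error *)

Section ErrorDynamics.
Variables (R : realType) (J M1 M2 KD : 'M[R]_3) (ke kP : R).
Variables (R0 : R -> 'M[R]_3) (Om0 u0 : R -> 'cV[R]_3).
Hypothesis Junit : J \in unitmx.

(* Equal to [hat (Om0 t) + obs_L1 J M1 Om0 t]. *)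
Definition obs_N t := gyro J (Om0 t) + M1.

Lemma usubmx_observer t Q du (z : 'cV[R]_(3 + 3)) :
  usubmx (observer J M1 M2 R0 Om0 t Q du z) =
  - (hat (Om0 t) *m usubmx z) + dsubmx z
  - obs_L1 J M1 Om0 t *m (usubmx z - Zk_vee R0 t Q).
Proof.
rewrite /observer -{1 2}(vsubmxK z) /obs_A /obs_B /obs_C /obs_L.
rewrite mul_block_col mul_row_col !mul_col_mx !mul0mx !mul1mx addr0.
by rewrite opp_col_mx !add_col_mx col_mxKu addr0 mulNmx.
Qed.

Lemma dsubmx_observer t Q du (z : 'cV[R]_(3 + 3)) :
  dsubmx (observer J M1 M2 R0 Om0 t Q du z) =
  gyro J (Om0 t) *m dsubmx z + invmx J *m du
  - obs_L2 J M1 M2 Om0 t *m (usubmx z - Zk_vee R0 t Q).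
Proof.
rewrite /observer -{1 2}(vsubmxK z) /obs_A /obs_B /obs_C /obs_L.
rewrite mul_block_col mul_row_col !mul_col_mx !mul0mx !mul1mx addr0.
by rewrite opp_col_mx !add_col_mx col_mxKd add0r.
Qed.

Lemma is_derive_obs_N (t : R) dw : is_derive t 1 Om0 dw ->
  is_derive t 1 obs_N (gyro J dw).
Proof.
move=> /(is_derive_linear_mx (gyro J)) Nd.
by have := is_deriveD Nd (is_derive_cst M1 t 1); rewrite addr0.
Qed.

(** Since [obs_L1] is - Om0^ plus [obs_N], the hat of Omega_0' and the derivative of [obs_L1] add up
    to the derivative of [obs_N]. *)
Lemma obs_L2E (t : R) dw : is_derive t 1 Om0 dw ->
  obs_L2 J M1 M2 Om0 t =
  - gyro J dw + obs_N t *m obs_N t - M1 *m obs_N t + M2.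
Proof.
move=> wd; have := is_derive_linear_mx (@hat R) wd.
move=> /is_deriveN /is_deriveD /(_ (is_derive_obs_N wd)) Ld.
rewrite /obs_L2.
have NE : hat (Om0 t) + obs_L1 J M1 Om0 t = obs_N t.
  by rewrite /obs_L1 !addrA subrr add0r.
rewrite NE !derive1E.
have -> : obs_L1 J M1 Om0 = (fun s => - hat (Om0 s)) + obs_N.
  by apply/funext => s; rewrite /obs_L1 -addrA.
have [_ ->] := Ld; have [_ ->] := wd.
by rewrite addrA subrr add0r.
Qed.

Lemma controller_error t (z : 'cV[R]_(3 + 3)) :
  invmx J *m (controller J Om0 kP KD u0 t z - u0 t) =
  - (gyro J (Om0 t) *m dsubmx z) - (kP *: usubmx z + KD *m dsubmx z).
Proof.
rewrite gyroE -[X in _ - X](mulKmx Junit) -mulmxN -mulmxBr; congr (_ *m _).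
rewrite /controller addrC !addrA addNr add0r -opprD (addrC (cross _ (Om0 t))).
by [].
Qed.

Variable X : R -> 'M[R]_3 * 'cV[R]_3 * 'cV[R]_(3 + 3).

Definition rot_err t := (R0 t)^T *m ((X t).1.1 - R0 t).
Definition att_err t := skewv (rot_err t).
Definition vel_err t := (X t).1.2 - Om0 t.
Definition obs_err1 t := att_err t - usubmx (X t).2.
Definition obs_err2 t := vel_err t - dsubmx (X t).2.
(* To first order, the derivative of [obs_err1]. *)
Definition obs_err_vel t := obs_err2 t - obs_N t *m obs_err1 t.

Definition att_rem t := skewv (rot_rem ke (rot_err t) (vel_err t)).
(** The feedback uses estimates. Replacing them by the true errors leaves terms linear in the
    observer error: these couple the observer to the tracking error and are not small compared with
    it. *)
Definition vel_rem t := gyro J (Om0 t) *m obs_err2 t + kP *: obs_err1 t +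
  KD *m obs_err2 t + gyro_rem J (vel_err t).

(** Both pairs are put in the shape y + G x + p, - K x - D y + q of [energy_decay]; for this reason
    the term with [G = 0] is kept in the derivative of [obs_err1]. *)
Lemma error_derivatives (t : R) :
  SO3 (R0 t) ->
  is_derive t 1 R0 (R0 t *m hat (Om0 t)) ->
  is_derive t 1 Om0 (euler_rhs J (Om0 t) (u0 t)) ->
  is_derive t 1 X (closed_loop J M1 M2 R0 Om0 kP KD u0 ke t (X t)) ->
  [/\ is_derive t 1 rot_err (rot_dot ke (Om0 t) (rot_err t) (vel_err t)),
      is_derive t 1 att_err
        (vel_err t + - hat (Om0 t) *m att_err t + att_rem t),
      is_derive t 1 vel_err
        (- (kP%:M *m att_err t) - KD *m vel_err t + vel_rem t),
      is_derive t 1 obs_err1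
        (obs_err_vel t + 0 *m obs_err1 t + att_rem t) &
      is_derive t 1 obs_err_vel
        (- (M2 *m obs_err1 t) - M1 *m obs_err_vel t +
         (gyro_rem J (vel_err t) - obs_N t *m att_rem t))].
Proof.
move=> R0t R0d wd Xd.
have X1d := is_derive_fst Xd.
have Qd := is_derive_fst X1d; have Omd := is_derive_snd X1d.
have zd := is_derive_snd Xd.
rewrite /closed_loop /= in Qd Omd zd.
have wE : (X t).1.2 = Om0 t + vel_err t by rewrite addrC subrK.
have rotd : is_derive t 1 rot_err (rot_dot ke (Om0 t) (rot_err t) (vel_err t)).
  by apply: is_derive_rot => //; rewrite -wE.
have attd : is_derive t 1 att_err
    (vel_err t + - hat (Om0 t) *m att_err t + att_rem t).
  by rewrite mulNmx; exact: is_derive_skewv_rot rotd.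
set du := controller J Om0 kP KD u0 t (X t).2 - u0 t in zd.
have veld : is_derive t 1 vel_err
    (gyro J (Om0 t) *m vel_err t + gyro_rem J (vel_err t) + invmx J *m du).
  by have := is_deriveB Omd wd; rewrite {1}wE euler_error.
have zuE : usubmx (X t).2 = att_err t - obs_err1 t by rewrite opprB addrCA subrr addr0.
have zdE : dsubmx (X t).2 = vel_err t - obs_err2 t by rewrite opprB addrCA subrr addr0.
have xE : Zk_vee R0 t (X t).1.1 = att_err t by [].
have duE := controller_error t (X t).2; rewrite -/du zuE zdE in duE.
have veld' : is_derive t 1 vel_err
    (- (kP%:M *m att_err t) - KD *m vel_err t + vel_rem t).
  apply: (is_derive_eq veld); rewrite duE /vel_rem mul_scalar_mx.
  move: (gyro_rem _ _) => r; move: (gyro J _) => N.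
  move: (att_err t) (vel_err t) (obs_err1 t) (obs_err2 t) => x y e1 e2.
  rewrite !mulmxBr scalerBr.
  move: (KD *m _) (KD *m _) (N *m _) (N *m _) => a b c d.
  by apply/matrixP => i j; rewrite !mxE; ring.
have e1d : is_derive t 1 obs_err1
    (obs_err_vel t + 0 *m obs_err1 t + att_rem t).
  have := is_deriveB attd (is_derive_linear_mx usubmx zd).
  move=> /is_derive_eq; apply; rewrite /= usubmx_observer xE zuE zdE.
  rewrite mul0mx addr0 /obs_err_vel /obs_N /obs_L1 -/(gyro J (Om0 t)).
  rewrite -[euler_lin J Om0 t]/(gyro J (Om0 t)).
  move: (att_err t) (vel_err t) (obs_err1 t) (obs_err2 t) (att_rem t) => x y e1 e2 p.
  rewrite (addrAC x) subrr add0r mulmxN opprK !mulmxDl mulmxBr !mulNmx.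
  move: (hat _ *m _) (hat _ *m _) (M1 *m _) (gyro _ _ *m _) => a b c d.
  by apply/matrixP => i j; rewrite !mxE; ring.
split=> //.
have e2d := is_deriveB veld (is_derive_linear_mx dsubmx zd).
have := is_deriveB e2d (is_derive_mulmx (is_derive_obs_N wd) e1d).
move=> /is_derive_eq; apply.
rewrite /= dsubmx_observer xE (obs_L2E wd) zuE zdE.
(* With gyro = N - M1 and e2 = v + N e1, the terms N N e1, M1 N e1 and N v cancel, and - M2 e1 - M1
   v remains. *)
have -> : gyro J (Om0 t) = obs_N t - M1 by rewrite addrK.
rewrite mul0mx addr0 [obs_err_vel]lock.
have -> : obs_err2 t = obs_err_vel t + obs_N t *m obs_err1 t by rewrite subrK.
rewrite -lock; move: (invmx J *m _) => d0; move: (gyro_rem _ _) (gyro _ _) => r N'.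
move: (att_err t) (vel_err t) (obs_err1 t) (obs_err_vel t) (att_rem t) (obs_N t).
move=> x y e1 v p N.
rewrite (addrAC x) subrr add0r.
rewrite !(mulmxDl, mulmxDr, mulNmx, mulmxN, mulmxA).
move: (M1 *m N *m e1) (N *m N *m e1) => a b; move: (M1 *m _) (M1 *m _) => c d.
move: (N *m _) (N *m _) (N *m _) (N' *m _) (M2 *m _) => e f g h k.
by apply/matrixP => i j; rewrite !mxE; ring.
Qed.

End ErrorDynamics.

(** * Lyapunov function of the cascade *)

Section Lyapunov.
Variable R : realType.

Lemma dot_skew n (G : 'M[R]_n) (x : 'cV[R]_n) : G^T = - G -> dot (G *m x) x = 0.
Proof.
move=> Gskew; have := dot_mull G x x.
by rewrite Gskew mulNmx dotNr (dotC x); lra.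
Qed.

(** Young's inequality bounds g S1 S2 by (c1/2) S1^2 + (g^2/c1) S2^2. The weight [b] makes b c2 = 1
    + g^2/c1, which pays for the last term and leaves S2^2. The factor 3 compares the squared sum
    with the sum of squares. *)
Lemma cascade_weight (c1 g c2 c3 : R) : 0 < c1 -> 0 < c2 -> 0 < c3 ->
  exists b a : R, [/\ 0 < b, 0 < a & forall S1 S2 S3,
    - c1 * S1 ^+ 2 + g * (S1 * S2) - b * (c2 * S2 ^+ 2) - c3 * S3 ^+ 2 <=
    - a * (S1 + S2 + S3) ^+ 2].
Proof.
move=> c10 c20 c30; pose h := g ^+ 2 / c1.
have h0 : 0 <= h by rewrite divr_ge0 ?sqr_ge0// ltW.
have hE : h * c1 = g ^+ 2 by rewrite divfK// gt_eqF.
pose a := Num.min (c1 / 2) (Num.min 1 c3).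
have a0 : 0 < a by rewrite !lt_min ltr01 c30 divr_gt0.
have a1 : a <= c1 / 2 by rewrite ge_min lexx.
have a2 : a <= 1 by rewrite !ge_min lexx orbT.
have a3 : a <= c3 by rewrite !ge_min lexx !orbT.
exists ((1 + h) / c2), (a / 3); split; [by rewrite divr_gt0//; lra|lra|].
move=> S1 S2 S3.
have -> : (1 + h) / c2 * (c2 * S2 ^+ 2) = (1 + h) * S2 ^+ 2.
  by rewrite mulrA divfK// gt_eqF.
have AG : g * (S1 * S2) <= c1 / 2 * S1 ^+ 2 + h * S2 ^+ 2.
  rewrite -(ler_pM2l c10) -subr_ge0.
  have -> : c1 * (c1 / 2 * S1 ^+ 2 + h * S2 ^+ 2) - c1 * (g * (S1 * S2)) =
      ((c1 * S1 - g * S2) ^+ 2 + g ^+ 2 * S2 ^+ 2) / 2.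
    by rewrite mulrDr (mulrA c1 h) (mulrC c1 h) hE; field.
  have := sqr_ge0 (c1 * S1 - g * S2); have := mulr_ge0 (sqr_ge0 g) (sqr_ge0 S2).
  lra.
have := ler_wpM2r (sqr_ge0 S1) a1; have := ler_wpM2r (sqr_ge0 S2) a2.
have := ler_wpM2r (sqr_ge0 S3) a3.
have := mulr_ge0 (ltW a0) (sqr_ge0 (S1 - S2)).
have := mulr_ge0 (ltW a0) (sqr_ge0 (S1 - S3)).
have := mulr_ge0 (ltW a0) (sqr_ge0 (S2 - S3)).
lra.
Qed.

(** Apart from g S2, the perturbations add at most K S^3 with K = (C1 + b C2 + C3) D. The radius is
    chosen so that K S <= a/2, which keeps half of the decay. *)
Lemma cascade_decay (c1 C1 c2 C2 c3 C3 g D rho0 : R) :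
  0 < c1 -> 0 <= C1 -> 0 < c2 -> 0 <= C2 -> 0 < c3 -> 0 <= C3 -> 0 <= D ->
  0 < rho0 ->
  exists b a rho : R, [/\ 0 < b, 0 < a & 0 < rho <= rho0] /\
    forall S1 S2 S3 T1 T2 T3, 0 <= S1 -> 0 <= S2 -> 0 <= S3 ->
      let S := S1 + S2 + S3 in S <= rho ->
      T1 <= g * S2 + D * S ^+ 2 -> T2 <= D * S ^+ 2 -> T3 <= D * S ^+ 2 ->
      (- c3 * S3 ^+ 2 + C3 * S3 * T3) + (- c1 * S1 ^+ 2 + C1 * S1 * T1) +
        b * (- c2 * S2 ^+ 2 + C2 * S2 * T2) <= - a * S ^+ 2.
Proof.
move=> c10 C10 c20 C20 c30 C30 D0 rho00.
have [b [a [b0 a0 Hcas]]] := cascade_weight (C1 * g) c10 c20 c30.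
pose K := (C1 + b * C2 + C3) * D.
have K0 : 0 <= K by rewrite mulr_ge0// addr_ge0// addr_ge0// mulr_ge0// ltW.
have K1 : 0 < 2 * (K + 1) by lra.
exists b, (a / 2), (Num.min rho0 (a / (2 * (K + 1)))); split.
  split=> //; first by rewrite divr_gt0.
  by rewrite lt_min rho00 divr_gt0//= ge_min lexx.
move=> S1 S2 S3 T1 T2 T3 S10 S20 S30 S; rewrite le_min => /andP[_ Sa] T1S T2S T3S.
have S2p := sqr_ge0 S.
have KS : K * S <= a / 2.
  move: Sa; rewrite ler_pdivlMr// => Sa.
  have S0 : 0 <= S by rewrite !addr_ge0.
  lra.
have DS0 : 0 <= D * S ^+ 2 by rewrite mulr_ge0.
have S1S : S1 <= S by rewrite /S -addrA lerDl addr_ge0.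
have S2S : S2 <= S by rewrite /S addrAC lerDr addr_ge0.
have S3S : S3 <= S by rewrite /S lerDr addr_ge0.
have {}KS := ler_wpM2r S2p KS.
have {}T1S := ler_wpM2l (mulr_ge0 C10 S10) T1S.
have {}T2S := ler_wpM2l (ltW b0) (ler_wpM2l (mulr_ge0 C20 S20) T2S).
have {}T3S := ler_wpM2l (mulr_ge0 C30 S30) T3S.
have {}S1S := ler_wpM2l C10 (ler_wpM2r DS0 S1S).
have {}S2S := ler_wpM2l (ltW b0) (ler_wpM2l C20 (ler_wpM2r DS0 S2S)).
have {}S3S := ler_wpM2l C30 (ler_wpM2r DS0 S3S).
have := Hcas S1 S2 S3; rewrite -/S.
have KE : K * S * S ^+ 2 = C1 * (S * (D * S ^+ 2)) +
    b * (C2 * (S * (D * S ^+ 2))) + C3 * (S * (D * S ^+ 2)) by rewrite /K; ring.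
move: (S) (K) KS KE T1S T2S T3S S1S S2S S3S {Sa S2p DS0 K0 K1} => S' K'.
lra.
Qed.

Lemma cascade_equiv (b m1 K1 m2 K2 K3 : R) :
  0 < b -> 0 < m1 -> 0 <= K1 -> 0 < m2 -> 0 <= K2 -> 0 < K3 ->
  exists m M : R, [/\ 0 < m, 0 < M & forall S1 S2 S3 V1 V2 V3 : R,
    0 <= S1 -> 0 <= S2 -> 0 <= S3 ->
    m1 * S1 ^+ 2 <= V1 <= K1 * S1 ^+ 2 -> m2 * S2 ^+ 2 <= V2 <= K2 * S2 ^+ 2 ->
    S3 ^+ 2 <= V3 <= K3 * S3 ^+ 2 ->
    m * (S1 + S2 + S3) ^+ 2 <= V3 + V1 + b * V2 <= M * (S1 + S2 + S3) ^+ 2].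
Proof.
move=> b0 m10 K10 m20 K20 K30.
pose n := Num.min m1 (Num.min (b * m2) 1).
have n0 : 0 < n by rewrite !lt_min m10 ltr01 mulr_gt0.
have n1 : n <= m1 by rewrite ge_min lexx.
have n2 : n <= b * m2 by rewrite !ge_min lexx orbT.
have n3 : n <= 1 by rewrite !ge_min lexx !orbT.
have bK20 : 0 <= b * K2 by rewrite mulr_ge0// ltW.
exists (n / 3), (K3 + K1 + b * K2); split; [lra|lra|].
move=> S1 S2 S3 V1 V2 V3 S10 S20 S30 /andP[l1 u1] /andP[l2 u2] /andP[l3 u3].
have {}l2 := ler_wpM2l (ltW b0) l2; have {}u2 := ler_wpM2l (ltW b0) u2.
apply/andP; split.
  have {}n1 := ler_wpM2r (sqr_ge0 S1) n1; have {}n2 := ler_wpM2r (sqr_ge0 S2) n2.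
  have {}n3 := ler_wpM2r (sqr_ge0 S3) n3.
  have := mulr_ge0 (ltW n0) (sqr_ge0 (S1 - S2)).
  have := mulr_ge0 (ltW n0) (sqr_ge0 (S1 - S3)).
  have := mulr_ge0 (ltW n0) (sqr_ge0 (S2 - S3)).
  lra.
have q1 : S1 ^+ 2 <= (S1 + S2 + S3) ^+ 2.
  by rewrite ler_sqr ?nnegrE ?addr_ge0// -addrA lerDl addr_ge0.
have q2 : S2 ^+ 2 <= (S1 + S2 + S3) ^+ 2.
  by rewrite ler_sqr ?nnegrE ?addr_ge0// addrAC lerDr addr_ge0.
have q3 : S3 ^+ 2 <= (S1 + S2 + S3) ^+ 2.
  by rewrite ler_sqr ?nnegrE ?addr_ge0// lerDr addr_ge0.
have {}q1 := ler_wpM2l K10 q1; have {}q2 := ler_wpM2l bK20 q2.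
have {}q3 := ler_wpM2l (ltW K30) q3.
lra.
Qed.

(** * Bounds on the nonlinear remainders and decay of the Lyapunov function *)

Lemma norm_rot_rem (ke : R) : 0 <= ke -> exists2 C : R, 0 <= C &
  forall Z y, `|Z| <= 1 -> `|rot_rem ke Z y| <= C * (`|Z| + `|y|) ^+ 2.
Proof.
move=> ke0; have [kh kh0 khP] := linear_mx_bounded (@hat R).
exists (3 * kh + 18 * ke) => [|Z y Z1]; first by lra.
have Z0 := normr_ge0 Z; have y0 := normr_ge0 y.
have b1 : `|Z *m hat y| <= 3 * kh * (`|Z| * `|y|).
  have := norm_mulmx Z (hat y); have := ler_wpM2l Z0 (khP y); lra.
have b2 : `|Z^T *m Z| <= 3 * `|Z| ^+ 2.
  by have := norm_mulmx Z^T Z; rewrite norm_trmx; lra.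
have b3 : `|Z *m (Z + Z^T + Z^T *m Z)| <= 15 * `|Z| ^+ 2.
  have := norm_mulmx Z (Z + Z^T + Z^T *m Z).
  have H : `|Z + Z^T + Z^T *m Z| <= 5 * `|Z|.
    have := ler_normD (Z + Z^T) (Z^T *m Z); have := ler_normD Z Z^T.
    rewrite norm_trmx; have := ler_wpM2l Z0 Z1; lra.
  have := ler_wpM2l Z0 H; lra.
have b4 : `|rot_rem ke Z y| <= 3 * kh * (`|Z| * `|y|) + ke * (18 * `|Z| ^+ 2).
  rewrite /rot_rem (le_trans (ler_normB _ _))// normrZ (ger0_norm ke0).
  apply: lerD => //; apply: ler_wpM2l => //.
  apply: le_trans (ler_normD _ _) _; lra.
have := mulr_ge0 ke0 (mulr_ge0 Z0 y0); have := mulr_ge0 ke0 (sqr_ge0 `|y|).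
have := mulr_ge0 kh0 (sqr_ge0 `|y|); have := mulr_ge0 kh0 (mulr_ge0 Z0 y0).
have := mulr_ge0 kh0 (sqr_ge0 `|Z|).
lra.
Qed.

Lemma norm_gyro_rem (J : 'M[R]_3) : exists2 C : R, 0 <= C &
  forall y, `|gyro_rem J y| <= C * `|y| ^+ 2.
Proof.
have [kh kh0 khP] := linear_mx_bounded (@hat R).
exists (3 * `|invmx J| * (3 * (kh * (3 * `|J|)))) => [|y]; first by rewrite !mulr_ge0.
rewrite /gyro_rem (le_trans (norm_mulmx _ _))// -(mulrA _ _ (`|y| ^+ 2)).
rewrite ler_wpM2l ?mulr_ge0// (le_trans (norm_mulmx _ _))//.
rewrite expr2 !mulrA ler_wpM2r// -!mulrA ler_wpM2l//.
rewrite (le_trans (khP _))// ler_wpM2l// (le_trans (norm_mulmx _ _))//.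
by rewrite -!mulrA.
Qed.

Lemma norm_skewv_le (Z : 'M[R]_3) (k : R) : (forall w, `|hat w| <= k * `|w|) ->
  `|Z| <= `|Z + Z^T| + k * `|skewv Z|.
Proof.
move=> kP; have {1}-> : Z = 2^-1 *: (Z + Z^T) + hat (skewv Z).
  by rewrite hat_skewv; apply/matrixP => i j; rewrite !mxE; field.
rewrite (le_trans (ler_normD _ _))// lerD//.
by rewrite normrZ ger0_norm ?invr_ge0// ler_piMl// invf_le1 ?ler1n.
Qed.

Variables (J M1 M2 KD : 'M[R]_3) (ke kP : R).

Definition lyapunov (eps1 eps2 b : R) Z y e1 v :=
  dot (Z + Z^T) (Z + Z^T) + energy kP%:M eps1 (skewv Z) y +
  b * energy M2 eps2 e1 v.

(** Time enters only through [w], the value of Omega_0, so estimates for bounded [w] are uniform in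
    time. *)
Definition lyapunov_dot (eps1 eps2 b : R) w Z y e1 e2 :=
  let N := gyro J w + M1 in let v := e2 - N *m e1 in
  let p := skewv (rot_rem ke Z y) in
  2 * dot (sym_rot_dot ke w Z y) (Z + Z^T) +
  energy_dot kP%:M eps1 (skewv Z) y (y + - hat w *m skewv Z + p)
    (- (kP%:M *m skewv Z) - KD *m y +
      (gyro J w *m e2 + kP *: e1 + KD *m e2 + gyro_rem J y)) +
  b * energy_dot M2 eps2 e1 v (v + 0 *m e1 + p)
    (- (M2 *m e1) - M1 *m v + (gyro_rem J y - N *m p)).

(** The three groups are the sizes S1, S2, S3 of the cascade: tracking, observer, symmetric part. *)
Definition err_size (Z : 'M[R]_3) (y e1 v : 'cV[R]_3) : R :=
  (`|skewv Z| + `|y|) + (`|e1| + `|v|) + `|Z + Z^T|.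

Lemma remainder_bounds (B : R) : 0 < ke -> 0 < kP -> 0 <= B ->
  exists rho g D : R, [/\ 0 < rho, 0 <= g & 0 <= D] /\
    forall w Z y e1 e2, `|w| <= B ->
      let N := gyro J w + M1 in let v := e2 - N *m e1 in
      let p := skewv (rot_rem ke Z y) in
      let S := err_size Z y e1 v in S <= rho ->
      [/\ `|p| + `|gyro J w *m e2 + kP *: e1 + KD *m e2 + gyro_rem J y| <=
           g * (`|e1| + `|v|) + D * S ^+ 2,
          `|p| + `|gyro_rem J y - N *m p| <= D * S ^+ 2 &
          `|rot_rem ke Z y + (rot_rem ke Z y)^T| <= D * S ^+ 2].
Proof.
move=> ke0 kP0 B0.
have [kh kh0 khP] := linear_mx_bounded (@hat R).
have [ks ks0 ksP] := linear_mx_bounded (@skewv R).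
have [kg kg0 kgP] := linear_mx_bounded (gyro J).
have [Cr Cr0 CrP] := norm_rot_rem (ltW ke0).
have [Cg Cg0 CgP] := norm_gyro_rem J.
pose nb := kg * B + `|M1|.
have nb0 : 0 <= nb by rewrite addr_ge0// mulr_ge0.
pose Cq := Cr * (2 + kh) ^+ 2.
have Cq0 : 0 <= Cq by rewrite mulr_ge0// sqr_ge0.
pose gn := 3 * (kg * B) + 3 * `|KD|.
have gn0 : 0 <= gn by rewrite addr_ge0// !mulr_ge0.
have kC0 : 0 <= ks * Cq by rewrite mulr_ge0.
have nkC0 : 0 <= 3 * nb * (ks * Cq) := mulr_ge0 (mulr_ge0 (ler0n _ 3) nb0) kC0.
(* The radius forces |Z| <= (1 + kh) S <= 1, where [norm_rot_rem] applies. The factor 1 + 3 nb in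
   the coupling bounds e2 = v + N e1 by |e1| + |v|. *)
exists (1 + kh)^-1, (gn * (1 + 3 * nb) + kP), (2 * Cq + ks * Cq + Cg + 3 * nb * (ks * Cq)).
have kh1 : 0 < 1 + kh by rewrite ltr_pwDl.
split.
  split; first by rewrite invr_gt0.
    by rewrite addr_ge0 ?(ltW kP0)// mulr_ge0// addr_ge0// mulr_ge0.
  by rewrite !addr_ge0// mulr_ge0.
move=> w Z y e1 e2 wB N v p S Srho.
have X0 := normr_ge0 (skewv Z); have Y0 := normr_ge0 y.
have E0 := normr_ge0 e1; have v0 := normr_ge0 v.
have Y30 := normr_ge0 (Z + Z^T).
have S0 : 0 <= S by rewrite /S /err_size !addr_ge0.
have S2p := sqr_ge0 S.
have yS : `|y| <= S.
  rewrite /S /err_size; lra.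
have xS : `|Z + Z^T| + `|skewv Z| <= S.
  by clear -Y0 E0 v0; rewrite /S /err_size; lra.
have ZS : `|Z| <= (1 + kh) * S.
  have := norm_skewv_le Z khP; have := ler_wpM2l kh0 xS.
  have := mulr_ge0 kh0 Y30; lra.
have Z1 : `|Z| <= 1.
  by have := ler_wpM2l (ltW kh1) Srho; rewrite mulfV ?gt_eqF//; exact: le_trans.
have rrS : `|rot_rem ke Z y| <= Cq * S ^+ 2.
  rewrite (le_trans (CrP Z y Z1))// /Cq -mulrA -exprMn ler_wpM2l//.
  rewrite ler_sqr ?nnegrE ?addr_ge0 ?mulr_ge0 ?addr_ge0//.
  lra.
have pS : `|p| <= ks * Cq * S ^+ 2.
  by rewrite (le_trans (ksP _))// -mulrA ler_wpM2l.
have rS : `|gyro_rem J y| <= Cg * S ^+ 2.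
  by rewrite (le_trans (CgP _))// ler_wpM2l// ler_sqr ?nnegrE.
have gB : `|gyro J w| <= kg * B by rewrite (le_trans (kgP _))// ler_wpM2l.
have NB : `|N| <= nb by rewrite (le_trans (ler_normD _ _))// lerD.
have NpS : `|N *m p| <= 3 * nb * (ks * Cq) * S ^+ 2.
  rewrite (le_trans (norm_mulmx _ _))// -(mulrA (3 * nb)) ler_pM// ?mulr_ge0//.
  by rewrite ler_wpM2l.
have e2S : `|e2| <= (1 + 3 * nb) * (`|e1| + `|v|).
  have -> : e2 = v + N *m e1 by rewrite subrK.
  have := ler_normD v (N *m e1); have := norm_mulmx N e1.
  have := ler_wpM2r E0 NB; have := mulr_ge0 nb0 v0.
  lra.
have q1S : `|gyro J w *m e2 + kP *: e1 + KD *m e2 + gyro_rem J y| <=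
    (gn * (1 + 3 * nb) + kP) * (`|e1| + `|v|) + Cg * S ^+ 2.
  rewrite (le_trans (ler_normD _ _))// lerD//.
  rewrite (le_trans (ler_normD _ _))//.
  have := ler_normD (gyro J w *m e2) (kP *: e1).
  rewrite normrZ (gtr0_norm kP0).
  have := norm_mulmx (gyro J w) e2; have := norm_mulmx KD e2.
  have := ler_wpM2r (normr_ge0 e2) gB.
  have := ler_wpM2l gn0 e2S.
  have := mulr_ge0 (ltW kP0) v0.
  rewrite /gn; lra.
have CqS := mulr_ge0 Cq0 S2p; have CgS := mulr_ge0 Cg0 S2p.
have kCS := mulr_ge0 kC0 S2p; have nkS := mulr_ge0 nkC0 S2p.
split.
- by lra.
- have := ler_normB (gyro_rem J y) (N *m p); lra.
- have := ler_normD (rot_rem ke Z y) (rot_rem ke Z y)^T; rewrite norm_trmx.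
  by lra.
Qed.

Lemma lyapunov_estimate (B : R) : posdefmx M1 -> posdefmx M2 -> posdefmx KD ->
  0 < ke -> 0 < kP -> 0 <= B ->
  exists eps1 eps2 b a m M rho : R, [/\ 0 < a, 0 < m, 0 < M & 0 < rho] /\
    forall w Z y e1 e2, `|w| <= B ->
      let v := e2 - (gyro J w + M1) *m e1 in let S := err_size Z y e1 v in
      m * S ^+ 2 <= lyapunov eps1 eps2 b Z y e1 v <= M * S ^+ 2 /\
      (S <= rho -> lyapunov_dot eps1 eps2 b w Z y e1 e2 <= - a * S ^+ 2).
Proof.
move=> M1pos M2pos KDpos ke0 kP0 B0.
have [kh kh0 khP] := linear_mx_bounded (@hat R).
have hB0 : 0 <= kh * B by rewrite mulr_ge0.
have [eps1 [c1 [C1 [m1 [K1 [[c10 C10 m10 K10] [V1b V1d]]]]]]] :=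
  energy_decay (posdef_scalar 3 kP0) KDpos hB0.
have [eps2 [c2 [C2 [m2 [K2 [[c20 C20 m20 K20] [V2b V2d]]]]]]] :=
  energy_decay M2pos M1pos (lexx 0).
have [rho0 [g [D [[rho00 g0 D0] Hrem]]]] := remainder_bounds ke0 kP0 B0.
have ke4 : 0 < 4 * ke by rewrite mulr_gt0.
(* By [sym_rot_decay], |Y|^2 decays with coefficient 4 ke. As <A, B> <= 9 |A| |B| for 3 x 3 matrices
   in the max norm, the remainder gets 18 here and the upper bound on <Y, Y> gets 9 below. *)
have [b [a [rho [[b0 a0 /andP[rho1 rho2]] Hdec]]]] :=
  cascade_decay g c10 C10 c20 C20 ke4 (ler0n R 18) D0 rho00.
have [m [M [m0 M0 Heqv]]] := cascade_equiv b0 m10 K10 m20 K20 (ltr0n R 9).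
exists eps1, eps2, b, a, m, M, rho; split=> //.
move=> w Z y e1 e2 wB v S.
have dY := dot_ge_norm (Z + Z^T).
split.
  apply: Heqv; rewrite ?addr_ge0// dY/=.
  by have /ler_normlP[_] := norm_dot (Z + Z^T) (Z + Z^T).
move=> Srho; have [T1 T2 T3] := Hrem w Z y e1 e2 wB (le_trans Srho rho2).
apply: le_trans (Hdec _ _ _ _ _ _ _ _ _ Srho T1 T2 T3); rewrite ?addr_ge0//.
rewrite /lyapunov_dot sym_rot_decay; apply: lerD; [apply: lerD|].
- have /ler_normlP[_ H] := norm_dot (rot_rem ke Z y + (rot_rem ke Z y)^T) (Z + Z^T).
  have := ler_wpM2l (ltW ke4) dY; lra.
- apply: V1d; first by rewrite normrN (le_trans (khP _))// ler_wpM2l.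
  (* A scalar stiffness and the skewness of [hat w] give the cancellation required by
     [energy_decay]. *)
  by rewrite mul_scalar_mx dotZr dot_skew ?mulr0// trmxN hat_skew.
- rewrite ler_wpM2l ?(ltW b0)//; apply: V2d; first by rewrite normr0.
  by rewrite mul0mx /dot trmx0 mul0mx mxtrace0.
Qed.

End Lyapunov.

(** * Trajectories of the closed loop *)

Section ClosedLoop.
Variable R : realType.

Lemma cvg_linear_mx (T : Type) (F : set_system T) {FF : Filter F} m n
    (V : normedModType R) (L : {linear 'M[R]_(m, n) -> V}) (f : T -> 'M[R]_(m, n)) (a : 'M[R]_(m, n)) :
  f @ F --> a -> (fun x => L (f x)) @ F --> L a.
Proof.
move=> fa; exact: (@continuous_cvg _ _ _ F _ f L a (@linear_mx_continuous _ _ _ _ L a)).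
Qed.

Lemma cvg_fst_comp (T : Type) (F : set_system T) {FF : Filter F}
    (U V : topologicalType) (f : T -> U * V) (p : U * V) :
  f @ F --> p -> (fun x => (f x).1) @ F --> p.1.
Proof. by move=> fp; apply: cvg_comp fp _; exact: cvg_fst. Qed.

Lemma cvg_snd_comp (T : Type) (F : set_system T) {FF : Filter F}
    (U V : topologicalType) (f : T -> U * V) (p : U * V) :
  f @ F --> p -> (fun x => (f x).2) @ F --> p.2.
Proof. by move=> fp; apply: cvg_comp fp _; exact: cvg_snd. Qed.

Lemma bounded_within (V : normedModType R) (f : R -> V) (A : set R) :
  [bounded f t | t in A] -> exists2 B : R, 0 <= B & forall t, A t -> `|f t| <= B.
Proof.
move=> [B [_ BP]]; exists (`|B| + 1) => [|t At]; first by rewrite addr_ge0.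
by apply: (BP (`|B| + 1)) => //; rewrite ltr_pwDr// ler_norm.
Qed.

(** At each time the change of variables is linear and invertible, R0^T being the inverse of R0. The
    bound on the reference makes it and its inverse uniformly bounded. *)
Lemma err_norm_equiv (J M1 : 'M[R]_3) (B : R) : 0 <= B ->
  exists A1 A2 : R, [/\ 0 < A1, 0 < A2 &
    forall (r0 dR : 'M[R]_3) w y (e : 'cV[R]_(3 + 3)),
      SO3 r0 -> `|r0| <= B -> `|w| <= B ->
      let S := err_size (r0^T *m dR) y (usubmx e)
        (dsubmx e - (gyro J w + M1) *m usubmx e) in
      S <= A1 * `|(dR, y, e)| /\ `|(dR, y, e)| <= A2 * S].
Proof.
move=> B0.
have [kh kh0 khP] := linear_mx_bounded (@hat R).
have [ks ks0 ksP] := linear_mx_bounded (@skewv R).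
have [kg kg0 kgP] := linear_mx_bounded (gyro J).
pose nb := kg * B + `|M1|.
have nb0 : 0 <= nb by rewrite addr_ge0// mulr_ge0.
have ksB := mulr_ge0 ks0 B0; have khB := mulr_ge0 B0 kh0.
exists ((ks + 2) * (3 * B) + 3 + 3 * nb), (3 * B * (1 + kh) + 3 + 3 * nb).
split; [lra|lra|].
move=> r0 dR w y e [orth _] r0B wB; set Z := _ *m dR.
set e1 := usubmx e; set e2 := dsubmx e; set v := e2 - _ => S.
have NB : `|gyro J w + M1| <= nb.
  by rewrite (le_trans (ler_normD _ _))// lerD// (le_trans (kgP _))// ler_wpM2l.
have Ne : `|(gyro J w + M1) *m e1| <= 3 * nb * `|e1|.
  by rewrite (le_trans (norm_mulmx _ _))// ler_wpM2r// ler_wpM2l.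
have n1 : `|(dR, y, e)| = Num.max (Num.max `|dR| `|y|) `|e| by [].
have ZR : `|Z| <= 3 * B * `|dR|.
  by rewrite (le_trans (norm_mulmx _ _))// norm_trmx ler_wpM2r// ler_wpM2l.
have RZ : dR = r0 *m Z by rewrite mulmxA (mulmx1C orth) mul1mx.
have RZ' : `|dR| <= 3 * B * `|Z|.
  by rewrite {1}RZ (le_trans (norm_mulmx _ _))// ler_wpM2r// ler_wpM2l.
have d0 := normr_ge0 dR; have y0 := normr_ge0 y; have e0 := normr_ge0 e.
have v0 := normr_ge0 v; have e10 := normr_ge0 e1.
have Y0 := normr_ge0 (Z + Z^T); have x0 := normr_ge0 (skewv Z).
rewrite n1; set n := Num.max _ _.
have dn : `|dR| <= n by rewrite /n !le_max lexx.
have yn : `|y| <= n by rewrite /n !le_max lexx orbT.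
have en : `|e| <= n by rewrite /n le_max lexx orbT.
have n0 : 0 <= n by apply: le_trans yn.
split.
  have e1e : `|e1| <= `|e| by apply: norm_mx_le => // i j; rewrite mxE norm_entry.
  have e2e : `|e2| <= `|e| by apply: norm_mx_le => // i j; rewrite mxE norm_entry.
  have := ler_normB e2 ((gyro J w + M1) *m e1).
  have := ksP Z; have := ler_normD Z Z^T; rewrite norm_trmx.
  have := ler_wpM2l ks0 ZR; have := ler_wpM2l ksB dn; have := ler_wpM2l B0 dn.
  have := ler_wpM2l nb0 (le_trans e1e en).
  rewrite /S /err_size -/v; lra.
have ZS := norm_skewv_le Z khP.
have e2v : `|e2| <= `|v| + 3 * nb * `|e1|.
  have := ler_normD v ((gyro J w + M1) *m e1); rewrite subrK; lra.
have eS : `|e| <= `|e1| + `|e2|.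
  rewrite -(vsubmxK e); apply: norm_mx_le => [|i j]; first exact: addr_ge0.
  rewrite mxE; case: splitP => k _; apply: le_trans (norm_entry _ _ _) _;
  by rewrite ?lerDl ?lerDr.
have S0 : 0 <= S by rewrite /S /err_size !addr_ge0.
have c1 : 0 <= B * kh * (S - `|skewv Z|).
  by rewrite mulr_ge0// subr_ge0 /S /err_size; lra.
have c2 : 0 <= B * (S - `|Z + Z^T|).
  by rewrite mulr_ge0// subr_ge0 /S /err_size; lra.
have c3 : 0 <= nb * (S - `|e1|).
  by rewrite mulr_ge0// subr_ge0 /S /err_size; lra.
have c4 := ler_wpM2l B0 ZS.
have BS := mulr_ge0 B0 S0; have kS := mulr_ge0 khB S0; have nS := mulr_ge0 nb0 S0.
have SE : `|y| + `|v| + `|e1| <= S by rewrite /S /err_size -/v; lra.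
by rewrite /n !ge_max -andbA; apply/and3P; split; lra.
Qed.

Lemma closed_loop_reference (J M1 M2 KD : 'M[R]_3) (ke kP : R) R0 Om0 u0 (t : R) :
  SO3 (R0 t) ->
  closed_loop J M1 M2 R0 Om0 kP KD u0 ke t (R0 t, Om0 t, 0) =
  (rigid_body J u0 t (R0 t, Om0 t), 0).
Proof.
move=> [orth _]; rewrite /closed_loop /=.
have -> : controller J Om0 kP KD u0 t 0 = u0 t.
  by rewrite /controller !linear0 -!hatE !mulmx0 linear0 mul0mx ?scaler0 ?addr0 ?mulmx0 !subr0.
rewrite /extended_rigid_body /= orth subrr mulmx0 scaler0 subr0.
rewrite /observer subrr !mulmx0 add0r /Zk_vee subrr mulmx0 trmx0 subr0 scaler0.
by rewrite (linear0 (@vee R)) subr0 mulmx0 subr0.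
Qed.

Lemma is_derive_lyapunov (M2 : 'M[R]_3) (kP eps1 eps2 b : R)
    (Z : R -> 'M[R]_3) (y e1 v : R -> 'cV[R]_3) (t : R) dY dx dy de1 dv :
  M2^T = M2 -> is_derive t 1 (fun s => Z s + (Z s)^T) dY ->
  is_derive t 1 (fun s => skewv (Z s)) dx -> is_derive t 1 y dy ->
  is_derive t 1 e1 de1 -> is_derive t 1 v dv ->
  is_derive t 1 (fun s => lyapunov M2 kP eps1 eps2 b (Z s) (y s) (e1 s) (v s))
    (2 * dot dY (Z t + (Z t)^T) + energy_dot kP%:M eps1 (skewv (Z t)) (y t) dx dy +
     b * energy_dot M2 eps2 (e1 t) (v t) de1 dv).
Proof.
move=> M2sym Yd xd yd e1d vd.
have := is_deriveD (is_deriveD (is_derive_dot Yd Yd)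
    (is_derive_energy eps1 (tr_scalar_mx 3 kP) xd yd))
  (is_deriveZ b (is_derive_energy eps2 M2sym e1d vd)).
move=> /is_derive_eq; apply; congr (_ + _ + _).
by rewrite (dotC (Z t + (Z t)^T) dY) mulr_natl mulr2n.
Qed.

Section Continuity.
Variables (T : Type) (F : set_system T).
Context {FF : Filter F}.

Lemma cvg_energy n (K : 'M[R]_n) (eps : R) (f g : T -> 'cV[R]_n) (a c : 'cV[R]_n) :
  f @ F --> a -> g @ F --> c -> (fun s => energy K eps (f s) (g s)) @ F --> energy K eps a c.
Proof.
move=> fa gc; apply: cvgD; last first.
  by apply: cvgM; [exact: cvg_cst|exact: cvg_dot].
apply: cvgD; last exact: cvg_dot.
by apply: cvg_dot => //; exact: (cvg_linear_mx (L := mulmx K) fa).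
Qed.

Lemma cvg_lyapunov (M2 : 'M[R]_3) (kP eps1 eps2 b : R)
    (Z : T -> 'M[R]_3) (y e1 v : T -> 'cV[R]_3)
    (z0 : 'M[R]_3) (y0 e0 v0 : 'cV[R]_3) :
  Z @ F --> z0 -> y @ F --> y0 -> e1 @ F --> e0 -> v @ F --> v0 ->
  (fun s => lyapunov M2 kP eps1 eps2 b (Z s) (y s) (e1 s) (v s)) @ F -->
    lyapunov M2 kP eps1 eps2 b z0 y0 e0 v0.
Proof.
move=> Zc yc ec vc; apply: cvgD; last first.
  by apply: cvgM; [exact: cvg_cst|exact: cvg_energy].
have Zt := cvg_linear_mx (FF := FF) (L := trmx) Zc.
have Zx := cvg_linear_mx (FF := FF) (L := @skewv R) Zc.
apply: cvgD; last exact: cvg_energy Zx yc.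
by apply: cvg_dot; exact: cvgD.
Qed.

End Continuity.

Section Trajectory.
Variables (J M1 M2 KD : 'M[R]_3) (ke kP : R).
Variables (R0 : R -> 'M[R]_3) (Om0 u0 : R -> 'cV[R]_3).
Hypothesis Jpos : posdefmx J.
Hypothesis ref : reference_trajectory J R0 Om0 u0.

Lemma reference_derivatives (t : R) : 0 < t ->
  is_derive t 1 R0 (R0 t *m hat (Om0 t)) /\
  is_derive t 1 Om0 (euler_rhs J (Om0 t) (u0 t)).
Proof.
move=> t0; have [_ [_ /(_ t t0 (ltry t)) d] _ _] := ref.
by split; [exact: (is_derive_fst d)|exact: (is_derive_snd d)].
Qed.

Lemma reference_cvg (A : set R) t : A `<=` [set s | 0 <= s] -> A t ->
  R0 @ within A (nbhs t) --> R0 t /\ Om0 @ within A (nbhs t) --> Om0 t.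
Proof.
move=> A0 At; have [_ [/(continuous_subspaceW _) c _] _ _] := ref.
have /subspace_continuousP/(_ _ At) := c A (fun s As => conj (A0 s As) (ltry s)).
by move=> d; split; [exact: (cvg_fst_comp d)|exact: (cvg_snd_comp d)].
Qed.

Lemma reference_bounded : exists2 B : R, 0 <= B &
  forall t, 0 <= t -> `|R0 t| <= B /\ `|Om0 t| <= B.
Proof.
have [_ _ /bounded_within[B B0 BP] _] := ref; exists B => // t t0.
have := BP t (conj t0 (ltry t)).
by have -> : `|(R0 t, Om0 t)| = Num.max `|R0 t| `|Om0 t| by []; rewrite ge_max => /andP.
Qed.

Variables (t0 : R) (T : \bar R) (X : R -> 'M[R]_3 * 'cV[R]_3 * 'cV[R]_(3 + 3)).
Hypothesis t00 : 0 <= t0.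
Hypothesis Xsol : ode_solution (closed_loop J M1 M2 R0 Om0 kP KD u0 ke) t0 T X.

Definition lyapunov_along eps1 eps2 b t :=
  lyapunov M2 kP eps1 eps2 b (rot_err R0 X t) (vel_err Om0 X t)
    (obs_err1 R0 X t) (obs_err_vel J M1 R0 Om0 X t).

Lemma lyapunov_along_derive eps1 eps2 b t : M2^T = M2 ->
  t0 < t -> (t%:E < T)%E ->
  is_derive t 1 (lyapunov_along eps1 eps2 b)
    (lyapunov_dot J M1 M2 KD ke kP eps1 eps2 b (Om0 t) (rot_err R0 X t)
      (vel_err Om0 X t) (obs_err1 R0 X t) (obs_err2 Om0 X t)).
Proof.
move=> M2sym t0t tT; have t0p : 0 < t := le_lt_trans t00 t0t.
have [R0d wd] := reference_derivatives t0p.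
have R0t : SO3 (R0 t) by have [/(_ t (ltW t0p))] := ref.
have [Zd xd yd e1d vd] := error_derivatives (posdef_unitmx Jpos) R0t R0d wd (Xsol.2 t t0t tT).
exact: is_derive_lyapunov M2sym (is_derive_sym_rot Zd) xd yd e1d vd.
Qed.

(** Derivatives are available only after [t0]. Continuity up to [t0] itself comes from that of the
    reference and of the trajectory relative to the interval. *)
Lemma lyapunov_along_continuous eps1 eps2 b :
  {within time_interval t0 T, continuous (lyapunov_along eps1 eps2 b)}.
Proof.
apply/subspace_continuousP => t It.
have sub0 : time_interval t0 T `<=` [set s | 0 <= s].
  by move=> s [t0s _]; exact: le_trans t0s.
have [Rc wc] := reference_cvg sub0 It.
have /subspace_continuousP/(_ _ It) Xc := Xsol.1.
have FI : Filter (within (time_interval t0 T) (nbhs t)) by exact: within_filter.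
have Xc1 := @cvg_fst_comp _ _ FI _ _ _ _ Xc.
have Xc2 := @cvg_snd_comp _ _ FI _ _ _ _ Xc.
have Qc := @cvg_fst_comp _ _ FI _ _ _ _ Xc1.
have Oc := @cvg_snd_comp _ _ FI _ _ _ _ Xc1.
have Zc : rot_err R0 X @ within (time_interval t0 T) (nbhs t) --> rot_err R0 X t.
  by apply: cvg_mulmx; [exact: (cvg_linear_mx (L := trmx) Rc)|exact: cvgB].
have yc : vel_err Om0 X @ within (time_interval t0 T) (nbhs t) --> vel_err Om0 X t.
  exact: cvgB.
have e1c : obs_err1 R0 X @ within (time_interval t0 T) (nbhs t) --> obs_err1 R0 X t.
  apply: cvgB; first exact: (cvg_linear_mx (L := @skewv R) Zc).
  exact: (cvg_linear_mx (L := usubmx) Xc2).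
apply: cvg_lyapunov; [exact: Zc|exact: yc|exact: e1c|].
have e2c : obs_err2 Om0 X @ within (time_interval t0 T) (nbhs t) --> obs_err2 Om0 X t.
  apply: cvgB; first exact: yc.
  exact: (cvg_linear_mx (L := dsubmx) Xc2).
apply: cvgB; first exact: e2c.
apply: cvg_mulmx; last exact: e1c.
by apply: cvgD; [exact: (cvg_linear_mx (L := gyro J) wc)|exact: cvg_cst].
Qed.

End Trajectory.

End ClosedLoop.

(** * Exponential stability of the zero error *)

Lemma zero_error_solution (R : realType) (J M1 M2 KD : 'M[R]_3) (ke kP : R) R0 Om0 u0 :
  reference_trajectory J R0 Om0 u0 ->
  error_dynamics J M1 M2 R0 Om0 kP KD u0 ke 0 +oo%E (fun=> 0).
Proof.
move=> ref; exists (fun t => (R0 t, Om0 t, 0)); last first.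
  move=> t _; rewrite /error_coordinates /= !subrr /Zk_vee subrr mulmx0 trmx0 subr0.
  by rewrite subr0 scaler0 (linear0 (@vee R)) col_mx0.
split.
  apply/subspace_continuousP => t It.
  have [_ [/subspace_continuousP/(_ _ It) c _] _ _] := ref.
  have FI : Filter (within (time_interval 0 +oo) (nbhs t)) by exact: within_filter.
  exact: (cvg_pair c (cvg_cst (0 : 'cV[R]_(3 + 3)))).
move=> t t0 tT; have [R0SO [_ /(_ t t0 tT) d] _ _] := ref.
rewrite closed_loop_reference; last exact: R0SO (ltW t0).
exact: is_derive_pair d (is_derive_cst 0 _ _).
Qed.

(** Allows 1 + M/m to stand for the square root of M/m in the overshoot constant. *)
Lemma le_sqrD1 (R : realType) (z : R) : 0 <= z -> z <= (1 + z) ^+ 2.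
Proof. by move=> z0; have := sqr_ge0 z; lra. Qed.

Lemma err_size_ge0 (R : realType) Z (y e1 v : 'cV[R]_3) : 0 <= err_size Z y e1 v.
Proof. by rewrite !addr_ge0. Qed.

Unset Implicit Arguments.

Theorem theorem6 (R : realType) (J : 'M[R]_3) (ke : R)
  (R0 : R -> 'M[R]_3) (Om0 u0 : R -> 'cV[R]_3)
  (M1 M2 : 'M[R]_3) (kP : R) (KD : 'M[R]_3) :
  posdefmx J -> 0 < ke ->
  reference_trajectory J R0 Om0 u0 ->
  posdefmx M1 -> posdefmx M2 ->
  0 < kP -> posdefmx KD ->
  exponentially_stable_origin (error_dynamics J M1 M2 R0 Om0 kP KD u0 ke).
Proof.
move=> Jpos ke0 ref M1pos M2pos kP0 KDpos; split; first exact: zero_error_solution.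
have [B B0 BP] := reference_bounded ref.
have [eps1 [eps2 [b [a [m [M [rho [[a0 m0 M0 rho0] HW]]]]]]]] :=
  lyapunov_estimate J M1pos M2pos KDpos ke0 kP0 B0.
have [A1 [A2 [A10 A20 HA]]] := err_norm_equiv J M1 B0.
(* A stand-in for the square root of m/M: n^2 <= n <= m/M. *)
pose n := Num.min 1 (m / M).
have n0 : 0 < n by rewrite lt_min ltr01 divr_gt0.
have n1 : n <= 1 by rewrite ge_min lexx.
have nM : M * n <= m by rewrite mulrC -ler_pdivlMr// ge_min lexx orbT.
(* W decays at rate a/M and is comparable to the square of the error, so the error decays at half
   that rate. [A1] and [A2] convert between [xi] and [err_size]. *)
exists (rho * n / A1), (A2 * A1 * (1 + M / m)), (a / (2 * M)); split.
- by rewrite divr_gt0// mulr_gt0.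
- by rewrite mulr_gt0 ?mulr_gt0// addr_gt0// divr_gt0.
- by rewrite divr_gt0// mulr_gt0.
move=> t0 T xi t00 [X Xsol xiE] xi0 t t0t tT.
have I0 : time_interval t0 T t0.
  by split=> //; apply: le_lt_trans tT; rewrite lee_fin.
have It : time_interval t0 T t by [].
pose W := lyapunov_along J M1 M2 kP R0 Om0 X eps1 eps2 b.
pose S s := err_size (rot_err R0 X s) (vel_err Om0 X s) (obs_err1 R0 X s)
  (obs_err_vel J M1 R0 Om0 X s).
have pos s : time_interval t0 T s -> 0 <= s by move=> [t0s _]; exact: le_trans t0s.
have WS s : time_interval t0 T s -> m * S s ^+ 2 <= W s <= M * S s ^+ 2 /\
    (S s <= rho -> lyapunov_dot J M1 M2 KD ke kP eps1 eps2 b (Om0 s) (rot_err R0 X s)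
      (vel_err Om0 X s) (obs_err1 R0 X s) (obs_err2 Om0 X s) <= - a * S s ^+ 2).
  by move=> /pos/BP[_ wB]; exact: HW.
have SX s : time_interval t0 T s -> S s <= A1 * `|xi s| /\ `|xi s| <= A2 * S s.
  move=> Is; have [R0B wB] := BP s (pos s Is).
  have [/(_ s (pos s Is)) R0s _ _ _] := ref.
  have := HA _ ((X s).1.1 - R0 s) _ (vel_err Om0 X s)
    (col_mx (Zk_vee R0 s (X s).1.1) (vel_err Om0 X s) - (X s).2) R0s R0B wB.
  have -> : usubmx (col_mx (Zk_vee R0 s (X s).1.1) (vel_err Om0 X s) - (X s).2) = obs_err1 R0 X s.
    by rewrite linearB/= col_mxKu.
  have -> : dsubmx (col_mx (Zk_vee R0 s (X s).1.1) (vel_err Om0 X s) - (X s).2) = obs_err2 Om0 X s.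
    by rewrite linearB/= col_mxKd.
  by rewrite xiE.
have S0 s : 0 <= S s by exact: err_size_ge0.
(* Below the level m rho^2, the bound m S^2 <= W forces S <= rho, which is where the decay estimate
   is valid. *)
have W0lt : W t0 < m * rho ^+ 2.
  have [/andP[_ W0] _] := WS t0 I0; apply: (le_lt_trans W0).
  have S0lt : S t0 < rho * n.
    by have [+ _] := SX t0 I0 => /le_lt_trans; apply; rewrite mulrC -ltr_pdivlMr.
  have : S t0 ^+ 2 < (rho * n) ^+ 2 by rewrite ltr_sqr ?nnegrE// mulr_ge0// ltW.
  rewrite -(ltr_pM2l M0) => /lt_le_trans; apply.
  rewrite exprMn mulrCA mulrC ler_wpM2r ?sqr_ge0//.
  by apply: le_trans nM; rewrite ler_pM2l// expr2 ler_piMl// ltW.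
have Wc : {within time_interval t0 T, continuous W}.
  exact: (lyapunov_along_continuous ref t00 Xsol).
have Wd s := @lyapunov_along_derive _ _ _ _ _ _ _ _ _ _ Jpos ref _ _ _ t00
  Xsol eps1 eps2 b s M2pos.1.
have : W t <= W t0 * expR (- (a / M) * (t - t0)).
  apply: (lyapunov_decay (divr_ge0 (ltW a0) (ltW M0)) Wc Wd _ _ W0lt It) => s.
    move=> t0s sT Ws; have Is : time_interval t0 T s by split=> //; exact: ltW.
    have [/andP[mS WM] dW] := WS s Is.
    have Srho : S s <= rho.
      rewrite -ler_sqr ?nnegrE ?(ltW rho0)// -(ler_pM2l m0); exact: le_trans Ws.
    apply: (le_trans (dW Srho)); rewrite !mulNr lerN2 mulrAC ler_pdivrMr//.
    by rewrite -mulrA ler_pM2l// mulrC.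
  move=> Is; have [/andP[mS _] _] := WS s Is; apply: le_trans mS.
  by rewrite mulr_ge0 ?sqr_ge0// ltW.
have -> : - (a / M) * (t - t0) = 2%:R * (- (a / (2 * M)) * (t - t0)).
  by field; rewrite gt_eqF.
rewrite expRM_natl; set e := expR _ => Wt.
have e0 : 0 <= e by exact: expR_ge0.
have [S0x _] := SX t0 I0; have [_ xS] := SX t It.
have [/andP[_ W0] _] := WS t0 I0; have [/andP[Wl _] _] := WS t It.
have x0 := normr_ge0 (xi t0).
pose z := M / m.
have z0 : 0 <= z by rewrite divr_ge0// ltW.
have S0sq : S t0 ^+ 2 <= (A1 * `|xi t0|) ^+ 2.
  by rewrite ler_sqr ?nnegrE// mulr_ge0// ltW.
have Stsq : S t ^+ 2 <= z * (A1 * `|xi t0| * e) ^+ 2.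
  rewrite -(ler_pM2l m0) (mulrA m z) (mulrC m z) divfK ?gt_eqF//.
  apply: (le_trans Wl); apply: (le_trans Wt); rewrite exprMn (mulrA M).
  rewrite ler_wpM2r ?sqr_ge0//; apply: (le_trans W0).
  by rewrite ler_pM2l.
have Stz : S t ^+ 2 <= ((1 + z) * (A1 * `|xi t0| * e)) ^+ 2.
  apply: (le_trans Stsq); rewrite [leRHS]exprMn ler_wpM2r ?sqr_ge0//.
  exact: le_sqrD1.
rewrite ler_sqr ?nnegrE ?mulr_ge0 ?addr_ge0 ?(ltW A10)// in Stz.
apply: (le_trans xS).
have -> : A2 * A1 * (1 + M / m) * `|xi t0| * e = A2 * ((1 + z) * (A1 * `|xi t0| * e)).
  by rewrite /z; ring.
by rewrite ler_pM2l.
Qed.
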